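(* Let $G\sim\mathbb{G}(n,n,p_n)$ be a random bipartite graph with bipartition $(A_n,B_n)$, $|A_n|=|B_n|=n$, conditioned on the edge $(a,b)$ being present, where $a\in A_n$, $b\in B_n$ are fixed, and let $\kappa_n(a,b)$ be the Ricci curvature of the edge $(a,b)$ in $G$. Then: (a) If $np_n\to0$, then with probability $1-o(1)$ the edge $(a,b)$ is isolated (no other edges are incident to $a$ or $b$), and consequently $\kappa_n(a,b)=0$. (b) If $np_n\to\lambda$ with $0<\lambda<\infty$, then $\kappa_n(a,b)$ converges in distribution to $-2\left(1-\frac{1}{1+X_1}-\frac{1}{1+X_2}\right)_+$, where $X_1,X_2$ are independent Poisson($\lambda$) random variables. (c) If $np_n\to\infty$ and $np_n^2\to0$, then $\kappa_n(a,b)\to-2$ in probability. (d) If $np_n^2\to\infty$, then $\kappa_n(a,b)\to0$ in probability.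
   Context: In $\mathbb{G}(n,n,p)$ each pair in $A_n\times B_n$ is an edge independently with probability $p$. For a graph $G$, $d_G$ is the shortest-path metric, $N_G(v)$ the neighbour set and $d_v$ the degree of $v$; $m_v$ is the uniform probability measure on $N_G(v)$, and for an edge $(x,y)$ the Ricci curvature is $\kappa(x,y)=1-W_1(m_x,m_y)$, where $W_1$ is the Wasserstein-1 (transportation) distance with respect to $d_G$. $(t)_+=\max(t,0)$. *)

(* Defs.v *)
From HB Require Import structures.
From mathcomp Require Import all_boot all_order all_algebra.
From mathcomp Require Import all_classical all_reals all_analysis.

Set Implicit Arguments.
Unset Strict Implicit.
Unset Printing Implicit Defensive.

Import Order.TTheory GRing.Theory Num.Theory.
Import numFieldNormedType.Exports.
Local Open Scope classical_set_scope.
Local Open Scope ring_scope.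

(* The bipartite graph model.  Part sizes are N = m.+1 (so that the    *)
(* fixed vertices a, b exist).  A_N = inl 'I_N, B_N = inr 'I_N.        *)
(* A configuration w records which pairs (i,j) in A_N x B_N are edges. *)

Definition config (m : nat) := {ffun 'I_m.+1 * 'I_m.+1 -> bool}.

Definition vert (m : nat) := ('I_m.+1 + 'I_m.+1)%type.

Definition adj (m : nat) (w : config m) (u v : vert m) : bool :=
  match u, v with
  | inl i, inr j => w (i, j)
  | inr j, inl i => w (i, j)
  | _, _ => false
  end.

Fixpoint reach (m : nat) (w : config m) (k : nat) (u v : vert m) : bool :=
  match k with
  | 0 => u == v
  | k'.+1 => reach w k' u v || [exists z, reach w k' u z && adj w z v]
  end.

(* shortest-path distance d_G; for disconnected pairs it takes the
   (irrelevant) value #|vert m| *)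
Definition dist (m : nat) (w : config m) (u v : vert m) : nat :=
  find (fun k => reach w k u v) (iota 0 #|{: vert m}|).

Definition nbhd (m : nat) (w : config m) (u : vert m) : {set vert m} :=
  [set v | adj w u v].

Definition deg (m : nat) (w : config m) (u : vert m) : nat := #|nbhd w u|.

Definition unif_nbhd {R : realType} (m : nat) (w : config m) (u : vert m)
  (v : vert m) : R :=
  if v \in nbhd w u then (deg w u)%:R^-1 else 0.

Definition coupling {R : realType} (m : nat) (mu nu : vert m -> R)
  (pi : {ffun vert m * vert m -> R}) : Prop :=
  [/\ forall z, 0 <= pi z,
      forall u, \sum_(v : vert m) pi (u, v) = mu u
    & forall v, \sum_(u : vert m) pi (u, v) = nu v].

Definition W1 {R : realType} (m : nat) (w : config m) (mu nu : vert m -> R) : R :=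
  inf [set c : R | exists pi, coupling mu nu pi /\
        c = \sum_(z : vert m * vert m) pi z * (dist w z.1 z.2)%:R].

Definition ricci {R : realType} (m : nat) (w : config m) (x y : vert m) : R :=
  1 - W1 w (@unif_nbhd R m w x) (unif_nbhd w y).

(* Law of G ~ G(N,N,p) conditioned on the edge (a,b) being present:
   the pair (a,b) is an edge and every other pair is an edge
   independently with probability p. *)
Definition cond_weight {R : realType} (m : nat) (p : R) (a b : 'I_m.+1)
  (w : config m) : R :=
  (w (a, b))%:R *
  \prod_(e : 'I_m.+1 * 'I_m.+1 | e != (a, b)) (if w e then p else 1 - p).

Definition cond_prob {R : realType} (m : nat) (p : R) (a b : 'I_m.+1)
  (E : pred (config m)) : R :=
  \sum_(w : config m | E w) cond_weight p a b w.

Definition cond_expect {R : realType} (m : nat) (p : R) (a b : 'I_m.+1)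
  (X : config m -> R) : R :=
  \sum_(w : config m) cond_weight p a b w * X w.

Definition isolated_edge (m : nat) (a b : 'I_m.+1) (w : config m) : bool :=
  [&& w (a, b), [forall j, (j != b) ==> ~~ w (a, j)]
              & [forall i, (i != a) ==> ~~ w (i, b)]].

Definition kappa {R : realType} (m : nat) (a b : 'I_m.+1) (w : config m) : R :=
  ricci w (inl a) (inr b).

Definition limit_fun {R : realType} (k1 k2 : nat) : R :=
  -2 * Num.max (1 - (1 + k1%:R)^-1 - (1 + k2%:R)^-1) 0.

(* E f(g(X1,X2)) for X1, X2 independent Poisson(lam), as the limit of
   the partial sums of the (absolutely convergent) double series *)
Definition limit_expect {R : realType} (lam : R) (f : R -> R) : R :=
  lim ((fun N : nat => \sum_(k1 < N) \sum_(k2 < N)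
          poisson_pmf lam k1 * poisson_pmf lam k2 * f (limit_fun k1 k2))
       @ \oo).

(* Main.v *)
(** For [y] a neighbour of [a] and [x] a neighbour of [b], the distance from [y]
to [x] is 1 when [xy] is an edge and 3 otherwise (through [y a b x]). Hence
[kappa = -2 (1 - M)], where [M] is the largest mass that can be moved from
[m_a] to [m_b] along edges: a partial coupling supported on edges bounds [M]
from below, weak Kantorovich duality bounds it from above.

If no 4-cycle passes through [ab], only [a] and [b] can serve, which gives
[kappa = limit_fun (d_a - 1) (d_b - 1)]. When [np] tends to [lam] the expected
number of such 4-cycles, of order [n^2 p^3], tends to 0, and the two degrees are
independent binomials that converge to Poisson variables. When [np] tends to
infinity and [n p^2] to 0, [M] is at most [1/d_a + 1/d_b] plus the mass of the
neighbours of [a] lying on a 4-cycle, all of which have vanishing expectation.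
When [n p^2] tends to infinity, the flow equal to [1 / (n^2 p^3)] on each edge
between the two neighbourhoods has marginals close to [m_a] and [m_b] in mean
[L1] distance, by variance bounds on sums of edge indicators. *)

Require Import Defs.
From HB Require Import structures.
From mathcomp Require Import all_boot all_order all_algebra.
From mathcomp Require Import all_classical all_reals all_analysis.
From mathcomp Require Import ring lra.
Import Order.TTheory GRing.Theory Num.Theory.
Import numFieldNormedType.Exports.
Local Open Scope classical_set_scope.
Local Open Scope ring_scope.

Set Implicit Arguments.
Unset Strict Implicit.
Unset Printing Implicit Defensive.

(** * Expectations of edge monomials *)

Section CondExpect.
Variables (R : realType) (m : nat) (p : R) (a b : 'I_m.+1).
Hypothesis p01 : 0 <= p <= 1.

Local Notation edge := ('I_m.+1 * 'I_m.+1)%type.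
Local Notation E := (cond_expect p a b).

(** Independence of the edges: the sum over configurations of a product over edges factors by
    distributivity. The forced edge contributes only its value at [true]. *)
Lemma cond_expect_prod (h : edge -> bool -> R) :
  E (fun w => \prod_e h e (w e)) =
  \prod_e (if e == (a, b) then h e true else p * h e true + (1 - p) * h e false).
Proof.
(* The factor [c%:R] at [(a, b)] encodes the conditioning as one more factor of the product
   measure. *)
pose g (e : edge) (c : bool) : R :=
  (if e == (a, b) then c%:R else if c then p else 1 - p) * h e c.
transitivity (\prod_e \sum_c g e c).
  rewrite bigA_distr_bigA /=; apply: eq_bigr => w _.
  rewrite /cond_weight [X in _ * X](bigD1 (a, b)) //= [RHS](bigD1 (a, b)) //=.
  rewrite [X in _ = _ * X](eq_bigr
    (fun e => (if w e then p else 1 - p) * h e (w e))); last first.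
    by move=> e /negbTE e_ab; rewrite /g e_ab.
  by rewrite big_split /= /g eqxx; ring.
apply: eq_bigr => e _; rewrite big_bool /g /=.
by case: eqP => _ //=; ring.
Qed.

Lemma cond_weight_ge0 (w : config m) : 0 <= cond_weight p a b w.
Proof.
have /andP[p0 p1] := p01.
rewrite /cond_weight mulr_ge0 ?ler0n //; apply: prodr_ge0 => e _.
by case: ifP => _; lra.
Qed.

Lemma cond_expectD (X Y : config m -> R) : E (fun w => X w + Y w) = E X + E Y.
Proof. by rewrite -big_split; apply: eq_bigr => w _; rewrite mulrDr. Qed.

Lemma cond_expectZ (c : R) (X : config m -> R) : E (fun w => c * X w) = c * E X.
Proof. by rewrite /cond_expect mulr_sumr; apply: eq_bigr => w _; ring. Qed.

Lemma cond_expect_sum (I : finType) (P : pred I) (X : I -> config m -> R) :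
  E (fun w => \sum_(i | P i) X i w) = \sum_(i | P i) E (X i).
Proof.
rewrite /cond_expect exchange_big /=.
by apply: eq_bigr => w _; rewrite mulr_sumr.
Qed.

Lemma cond_expect_cst (c : R) : E (fun=> c) = c.
Proof.
have -> : E (fun=> c) = c * E (fun=> 1) by rewrite -cond_expectZ mulr1.
pose h (_ : edge) (_ : bool) : R := 1.
have -> : E (fun=> 1) = E (fun w => \prod_e h e (w e)).
  by apply: eq_bigr => w _; rewrite big1.
rewrite cond_expect_prod big1 ?mulr1 // => e _.
by rewrite /h; case: ifP => _ //; ring.
Qed.

(** Configurations without the edge [(a, b)] have weight zero, so only those that contain it have to
    be compared. *)
Lemma le_cond_expect (X Y : config m -> R) :
  (forall w : config m, w (a, b) -> X w <= Y w) -> E X <= E Y.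
Proof.
move=> XY; apply: ler_sum => w _.
case wab: (w (a, b)); first by rewrite ler_wpM2l ?cond_weight_ge0 ?XY.
by rewrite /cond_weight wab !mul0r.
Qed.

Lemma eq_cond_expect (X Y : config m -> R) :
  (forall w : config m, w (a, b) -> X w = Y w) -> E X = E Y.
Proof.
by move=> XY; apply: le_anti; rewrite !le_cond_expect // => w wab; rewrite XY.
Qed.

Lemma cond_probE (P : pred (config m)) :
  cond_prob p a b P = E (fun w => (P w)%:R).
Proof.
rewrite /cond_prob big_mkcond; apply: eq_bigr => w _.
by case: (P w); rewrite ?mulr1 ?mulr0.
Qed.

Lemma cond_prob_markov (X : config m -> R) (eps : R) : 0 < eps ->
  (forall w : config m, w (a, b) -> 0 <= X w) ->
  cond_prob p a b (fun w => eps < X w) <= eps^-1 * E X.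
Proof.
move=> eps0 X0; rewrite cond_probE -cond_expectZ.
apply: le_cond_expect => w /X0 X0w; case: ltP => [lt_eps | _] /=.
  by rewrite mulrC ler_pdivlMr // mul1r ltW.
by rewrite mulr_ge0 // invr_ge0 ltW.
Qed.

(** A real monomial rather than a boolean, so that products and squares of such indicators can be
    expanded under the expectation. *)
Definition edges_present (S : {set edge}) (w : config m) : R :=
  \prod_(e in S) (w e)%:R.

Lemma edges_presentU S T w :
  edges_present (S :|: T) w = edges_present S w * edges_present T w.
Proof.
rewrite /edges_present (big_mkcond (mem S)) (big_mkcond (mem T)) /=.
rewrite -big_split big_mkcond /=; apply: eq_bigr => e _; rewrite !inE.
by case: (e \in S); case: (e \in T); case: (w e); rewrite ?mulr1 ?mul1r ?mul0r.
Qed.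

Lemma edges_present0 w : edges_present finset.set0 w = 1.
Proof. by rewrite /edges_present big_set0. Qed.

Lemma edges_present1 e w : edges_present [set e]%SET w = (w e)%:R.
Proof. by rewrite /edges_present big_set1. Qed.

Lemma cond_expect_edges (S : {set edge}) : (a, b) \notin S ->
  E (edges_present S) = p ^+ #|S|.
Proof.
move=> abS.
pose h e (c : bool) : R := if e \in S then c%:R else 1.
have -> : E (edges_present S) = E (fun w => \prod_e h e (w e)).
  by apply: eq_bigr => w _; rewrite /edges_present big_mkcond.
rewrite cond_expect_prod (bigID (mem S)) /= [X in _ * X]big1 ?mulr1.
  rewrite (eq_bigr (fun=> p)) ?prodr_const // => e eS; rewrite /h eS.
  case: eqP => [e_ab|_]; last by rewrite mulr1 mulr0 addr0.
  by rewrite -e_ab eS in abS.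
by move=> e /negbTE eS; rewrite /h eS; case: ifP => _ //; ring.
Qed.

(** Given that the edges of [T] are present, the monomials of the [S i] are independent Bernoulli
    variables of parameter [p ^+ s], because all these edge sets are disjoint; their variances add
    up. *)
Lemma cond_expect_variance (I : finType) (J : {set I}) (S : I -> {set edge})
    (T : {set edge}) (s : nat) :
  (a, b) \notin T ->
  (forall i, i \in J -> [/\ (a, b) \notin S i, #|S i| = s & T :&: S i = finset.set0]) ->
  (forall i j, i \in J -> j \in J -> i != j -> S i :&: S j = finset.set0) ->
  E (fun w => edges_present T w *
       (\sum_(i in J) edges_present (S i) w - #|J|%:R * p ^+ s) ^+ 2) =
  p ^+ #|T| * (#|J|%:R * (p ^+ s * (1 - p ^+ s))).
Proof.
move=> abT SP Sdisj; set r := p ^+ s; set k := #|J|%:R : R.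
have cardU (A B : {set edge}) : A :&: B = finset.set0 -> #|A :|: B| = (#|A| + #|B|)%N.
  by move=> AB; rewrite cardsU AB cards0 subn0.
have ETi i : i \in J -> E (fun w => edges_present T w * edges_present (S i) w)
    = p ^+ #|T| * r.
  move=> iJ; have [abS cS dTS] := SP _ iJ.
  transitivity (E (edges_present (T :|: S i))).
    by apply: eq_cond_expect => w _; rewrite edges_presentU.
  by rewrite cond_expect_edges ?inE ?negb_or ?abT // cardU // cS exprD.
have ETij i j : i \in J -> j \in J -> E (fun w => edges_present T w *
    (edges_present (S i) w * edges_present (S j) w))
    = p ^+ #|T| * (if i == j then r else r ^+ 2).
  move=> iJ jJ; have [abS cS dTS] := SP _ iJ.
  have [abSj cSj dTSj] := SP _ jJ.
  case: eqVneq => [<-|ij].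
    rewrite -(ETi i) //; apply: eq_cond_expect => w _.
    by rewrite -edges_presentU finset.setUid.
  transitivity (E (edges_present (T :|: (S i :|: S j)))).
    by apply: eq_cond_expect => w _; rewrite !edges_presentU.
  rewrite cond_expect_edges ?inE ?negb_or ?abT ?abS //.
  rewrite !cardU ?Sdisj //; last by rewrite finset.setIUr dTS dTSj finset.setU0.
  by rewrite cS cSj !exprD -/r; ring.
(* Expansion of the square into second moments, the cross term and the constant term. *)
transitivity (\sum_(i in J) \sum_(j in J) E (fun w => edges_present T w *
    (edges_present (S i) w * edges_present (S j) w))
  + ((- 2 * (k * r)) * \sum_(i in J) E (fun w => edges_present T w * edges_present (S i) w)
  + (k * r) ^+ 2 * E (edges_present T))).
  under eq_bigr => i _ do rewrite -cond_expect_sum.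
  rewrite -!cond_expect_sum -!cond_expectZ -!cond_expectD.
  apply: eq_cond_expect => w _.
  under [X in _ = X + _]eq_bigr => i _ do rewrite -mulr_sumr -mulr_sumr.
  by rewrite -mulr_sumr -mulr_suml -mulr_sumr; ring.
rewrite cond_expect_edges // [X in _ + (_ * X + _)](eq_bigr (fun=> p ^+ #|T| * r)); last first.
  by move=> i iJ; rewrite ETi.
(* For fixed [i], the diagonal term gives [r] and each of the other [k - 1] terms gives [r ^+ 2]. *)
rewrite [X in X + _](eq_bigr (fun=> p ^+ #|T| * (r + (k - 1) * r ^+ 2))); last first.
  move=> i iJ; rewrite (eq_bigr _ (fun j => ETij i j iJ)) (bigD1 i) //= eqxx.
  rewrite (eq_bigr (fun=> p ^+ #|T| * r ^+ 2)); last first.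
    by move=> j /andP[jJ ji]; rewrite eq_sym (negbTE ji).
  rewrite sumr_const -mulr_natr.
  have -> : k = #|[pred j in J | j != i]|%:R + 1.
    rewrite /k [#|J|](cardD1 i) iJ natrD addrC; congr (_%:R + _).
    by apply: eq_card => j; rewrite !inE andbC.
  by ring.
by rewrite !sumr_const /k; ring.
Qed.

(* [2 |t| <= d + t^2 / d] with [d] the standard deviation. *)
Lemma cond_expect_abs (T : config m -> R) (X : config m -> R) (v : R) :
  (forall w, 0 <= T w) -> 0 < v -> E T <= 1 ->
  E (fun w => T w * X w ^+ 2) <= v ->
  E (fun w => T w * `|X w|) <= Num.sqrt v.
Proof.
move=> T0 v0 ET1 EX.
set d := Num.sqrt v; have d0 : 0 < d by rewrite sqrtr_gt0.
have dd : d ^+ 2 = v by rewrite sqr_sqrtr // ltW.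
apply: (@le_trans _ _ (E (fun w => d / 2 * T w + (2 * d)^-1 * (T w * X w ^+ 2)))).
  apply: le_cond_expect => w _.
  have -> : d / 2 * T w + (2 * d)^-1 * (T w * X w ^+ 2)
      = T w * ((2 * d)^-1 * (d ^+ 2 + X w ^+ 2)) by field; lra.
  rewrite ler_wpM2l // mulrC ler_pdivlMr; last lra.
  rewrite -[X w ^+ 2]real_normK ?num_real //.
  have := sqr_ge0 (`|X w| - d); rewrite sqrrB; lra.
rewrite cond_expectD !cond_expectZ.
apply: (@le_trans _ _ (d / 2 * 1 + (2 * d)^-1 * d ^+ 2)).
  by rewrite lerD // ler_wpM2l ?invr_ge0 ?dd //; lra.
by rewrite le_eqVlt; apply/orP; left; apply/eqP; field; lra.
Qed.

End CondExpect.

(** * Distances and couplings *)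

Section Distance.
Variables (m : nat) (w : config m).

Lemma dist_le (k : nat) (u v : vert m) : reach w k u v -> (dist w u v <= k)%N.
Proof.
move=> rk; rewrite /dist.
(* Past the end of the search list the bound is automatic, since [find] returns at most the length
   of the list. *)
have [k_lt|] := ltnP k #|{: vert m}|; last first.
  by apply: leq_trans; rewrite -[leqRHS](size_iota 0) find_size.
rewrite leqNgt; apply/negP => /(before_find 0%N).
by rewrite nth_iota // add0n rk.
Qed.

(** The bound on [k] accounts for the default value [#|vert m|] of the distance between unreachable
    vertices. *)
Lemma dist_ge (k : nat) (u v : vert m) : (k <= #|{: vert m}|)%N ->
  (forall i, (i < k)%N -> ~~ reach w i u v) -> (k <= dist w u v)%N.
Proof.
move=> k_le nr; rewrite leqNgt; apply/negP => d_lt.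
have d_lt' := leq_trans d_lt k_le.
have hs : has (fun k => reach w k u v) (iota 0 #|{: vert m}|).
  by rewrite has_find size_iota.
have := nth_find 0%N hs; rewrite nth_iota // add0n.
by apply/negP; exact: nr.
Qed.

Lemma reachS (k : nat) (u v z : vert m) :
  reach w k u z -> adj w z v -> reach w k.+1 u v.
Proof. by move=> rz zv /=; apply/orP; right; apply/existsP; exists z; rewrite rz. Qed.

Lemma dist_adj (x y : 'I_m.+1) : w (x, y) -> (dist w (inr y) (inl x) <= 1)%N.
Proof. by move=> wxy; apply: dist_le; apply: (@reachS 0 _ _ (inr y)) => /=. Qed.

Lemma dist_path3 (a b x y : 'I_m.+1) : w (a, b) -> w (a, y) -> w (x, b) ->
  (dist w (inr y) (inl x) <= 3)%N.
Proof.
move=> wab way wxb; apply: dist_le.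
apply: (@reachS 2 _ _ (inr b)) => //; apply: (@reachS 1 _ _ (inl a)) => //.
by apply: (@reachS 0 _ _ (inr y)) => /=.
Qed.

Lemma dist_ge1 (x y : 'I_m.+1) : (1 <= dist w (inr y) (inl x))%N.
Proof.
apply: dist_ge; first by rewrite card_sum card_ord addSn.
by case.
Qed.

Lemma reach1E (x y : 'I_m.+1) : reach w 1 (inr y) (inl x) = w (x, y).
Proof.
apply/orP/idP => [[//|/existsP[z /andP[/eqP <-]]]//|wxy].
by right; apply/existsP; exists (inr y); rewrite eqxx.
Qed.

Lemma reach1_same (y z : 'I_m.+1) : reach w 1 (inr y) (inr z) = (y == z).
Proof.
apply/orP/idP => [[|/existsP[u /andP[/eqP <-]]]//|/eqP ->].
by left.
Qed.

(** The two vertices lie on opposite sides, so a walk between them has odd length. With [0 < m]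
    there are at least four vertices, so the default distance also exceeds 3. *)
Lemma dist_ge3 (x y : 'I_m.+1) : (0 < m)%N -> ~~ w (x, y) ->
  (3 <= dist w (inr y) (inl x))%N.
Proof.
move=> m0 nxy; apply: dist_ge.
  rewrite card_sum card_ord; case: m m0 => // k _.
  by rewrite !addSn !addnS.
move=> [//|[_|[_|//]]]; first by rewrite reach1E.
apply/negP => /orP[r1|/existsP[[z|z] /andP[r1 zx]]] //.
  by move: r1; rewrite -/(reach w 1 _ _) reach1E (negbTE nxy).
move: r1; rewrite -/(reach w 1 _ _) reach1_same => /eqP yz.
by move: zx => /=; rewrite -yz (negbTE nxy).
Qed.

End Distance.

(** * Primal and dual transport bounds on the curvature *)

Section Transport.
Variables (R : realType) (m : nat) (a b : 'I_m.+1) (w : config m).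
Hypothesis wab : w (a, b).

(** The forced edge is left out, so that the size is a sum of [m] independent indicators; the degree
    is one more. *)
Definition nbrsA : {set 'I_m.+1} := [set y | (y != b) && w (a, y)]%SET.
Definition nbrsB : {set 'I_m.+1} := [set x | (x != a) && w (x, b)]%SET.

Local Notation da := (1 + #|nbrsA|%:R : R).
Local Notation db := (1 + #|nbrsB|%:R : R).
Local Notation mu := (fun y => (w (a, y))%:R / da).
Local Notation nu := (fun x => (w (x, b))%:R / db).

Lemma deg_inl : deg w (inl a) = #|nbrsA|.+1.
Proof.
rewrite -[RHS]add1n -(cards1 b) /deg.
have -> : nbhd w (inl a) = [set inr y | y in b |: nbrsA]%SET.
  apply/setP => -[x|y]; rewrite !inE /=.
    by apply/esym/negbTE/negP => /imsetP[].
  rewrite mem_imset; last by move=> ? ? [].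
  by rewrite !inE; case: eqVneq => //= ->.
rewrite card_imset; last by move=> ? ? [].
by rewrite cardsU1 !inE eqxx /= cards1.
Qed.

Lemma deg_inr : deg w (inr b) = #|nbrsB|.+1.
Proof.
rewrite -[RHS]add1n -(cards1 a) /deg.
have -> : nbhd w (inr b) = [set inl x | x in a |: nbrsB]%SET.
  apply/setP => -[x|y]; rewrite !inE /=; last first.
    by apply/esym/negbTE/negP => /imsetP[].
  rewrite mem_imset; last by move=> ? ? [].
  by rewrite !inE; case: eqVneq => //= ->.
rewrite card_imset; last by move=> ? ? [].
by rewrite cardsU1 !inE eqxx /= cards1.
Qed.

Lemma nbrsA_sum : #|nbrsA|%:R = \sum_(y | y != b) (w (a, y))%:R :> R.
Proof.
rewrite -sum1_card natr_sum big_mkcond [RHS]big_mkcond /=.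
by apply: eq_bigr => y _; rewrite inE; case: (y != b) => //=; case: (w _).
Qed.

Lemma nbrsB_sum : #|nbrsB|%:R = \sum_(x | x != a) (w (x, b))%:R :> R.
Proof.
rewrite -sum1_card natr_sum big_mkcond [RHS]big_mkcond /=.
by apply: eq_bigr => y _; rewrite inE; case: (y != a) => //=; case: (w _).
Qed.

Lemma da_gt0 : 0 < da. Proof. by rewrite ltr_wpDr. Qed.
Lemma db_gt0 : 0 < db. Proof. by rewrite ltr_wpDr. Qed.

Lemma mu_ge0 y : 0 <= mu y.
Proof. by rewrite mulr_ge0 // invr_ge0 ltW ?da_gt0. Qed.
Lemma nu_ge0 y : 0 <= nu y.
Proof. by rewrite mulr_ge0 // invr_ge0 ltW ?db_gt0. Qed.

Lemma sum_mu : \sum_y mu y = 1.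
Proof.
rewrite -mulr_suml (bigD1 b) //= wab -nbrsA_sum divff //.
by rewrite gt_eqF ?da_gt0.
Qed.

Lemma sum_nu : \sum_x nu x = 1.
Proof.
rewrite -mulr_suml (bigD1 a) //= wab -nbrsB_sum divff //.
by rewrite gt_eqF ?db_gt0.
Qed.

Lemma unif_nbhd_inl (v : vert m) :
  unif_nbhd w (inl a) v = (if v is inr y then mu y else 0) :> R.
Proof.
rewrite /unif_nbhd inE deg_inl -natr1 addrC; case: v => [//|y] /=.
by case: (w _); rewrite ?mul1r ?mul0r.
Qed.

Lemma unif_nbhd_inr (v : vert m) :
  unif_nbhd w (inr b) v = (if v is inl x then nu x else 0) :> R.
Proof.
rewrite /unif_nbhd inE deg_inr -natr1 addrC; case: v => [x|//] /=.
by case: (w _); rewrite ?mul1r ?mul0r.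
Qed.

Lemma cost_pair (pi : {ffun vert m * vert m -> R}) :
  \sum_z pi z * (dist w z.1 z.2)%:R = \sum_u \sum_v pi (u, v) * (dist w u v)%:R.
Proof. by rewrite pair_bigA; apply: eq_bigr => -[u v]. Qed.

(* The mass left over by [f] is moved by the normalised product of the residual
   marginals; if none is left, the normalising factor is [0^-1 = 0]. *)
Lemma coupling_of_partial (f : 'I_m.+1 -> 'I_m.+1 -> R) :
  (forall y x, 0 <= f y x) -> (forall y x, ~~ w (x, y) -> f y x = 0) ->
  (forall y, \sum_x f y x <= mu y) -> (forall x, \sum_y f y x <= nu x) ->
  exists pi, coupling (unif_nbhd w (inl a)) (unif_nbhd w (inr b)) pi /\
    \sum_z pi z * (dist w z.1 z.2)%:R <= 3 - 2 * \sum_y \sum_x f y x.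
Proof.
move=> f0 fw fmu fnu; set M := \sum_y _.
pose rY y := mu y - \sum_x f y x; pose rX x := nu x - \sum_y f y x.
have rY0 y : 0 <= rY y by rewrite subr_ge0.
have rX0 x : 0 <= rX x by rewrite subr_ge0.
have srY : \sum_y rY y = 1 - M by rewrite sumrB sum_mu.
have srX : \sum_x rX x = 1 - M by rewrite sumrB sum_nu exchange_big.
have M1 : 0 <= 1 - M by rewrite -srY sumr_ge0.
pose g y x := f y x + rY y * (rX x / (1 - M)).
(* If [1 - M] vanishes, so does every residual, and the default inverse does no harm. *)
have rYV y : rY y * ((1 - M) / (1 - M)) = rY y.
  have [M0|M0] := eqVneq (1 - M) 0; last by rewrite divff ?mulr1.
  move: srY; rewrite M0 => /eqP; rewrite psumr_eq0 // => /allP /(_ y).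
  by rewrite mem_index_enum => /(_ isT) /eqP ->; rewrite mul0r.
have rXV x : rX x * ((1 - M) / (1 - M)) = rX x.
  have [M0|M0] := eqVneq (1 - M) 0; last by rewrite divff ?mulr1.
  move: srX; rewrite M0 => /eqP; rewrite psumr_eq0 // => /allP /(_ x).
  by rewrite mem_index_enum => /(_ isT) /eqP ->; rewrite mul0r.
have h0 y x : 0 <= rY y * (rX x / (1 - M)).
  by rewrite mulr_ge0 // divr_ge0.
have g0 y x : 0 <= g y x by rewrite addr_ge0.
pose pi : {ffun vert m * vert m -> R} :=
  [ffun z => if z is (inr y, inl x) then g y x else 0].
exists pi; split; first split.
- by move=> [[?|y] [x|?]]; rewrite ffunE.
- move=> u; rewrite unif_nbhd_inl big_sumType /= [X in _ + X]big1; last first.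
    by move=> ? _; rewrite ffunE; case: u.
  rewrite addr0; case: u => [?|y]; first by rewrite big1 // => ? _; rewrite ffunE.
  under eq_bigr do rewrite ffunE.
  rewrite /g big_split /= -mulr_sumr -mulr_suml srX rYV /rY.
  by rewrite addrC subrK.
- move=> v; rewrite unif_nbhd_inr big_sumType /= [X in X + _]big1; last first.
    by move=> ? _; rewrite ffunE.
  rewrite add0r; case: v => [x|?]; last by rewrite big1 // => ? _; rewrite ffunE.
  under eq_bigr do rewrite ffunE.
  rewrite /g big_split /= -mulr_suml srY mulrCA rXV /rX.
  by rewrite addrC subrK.
(* The mass of [f] travels along edges at cost at most 1, the residual mass along paths through [a]
   and [b] at cost at most 3. *)
apply: (@le_trans _ _ (\sum_y \sum_x (f y x + 3 * (rY y * (rX x / (1 - M)))))).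
  rewrite cost_pair.
  rewrite big_sumType /= [X in X + _]big1 ?add0r; last first.
    by move=> ? _; rewrite big1 // => ? _; rewrite ffunE mul0r.
  apply: ler_sum => y _.
  rewrite big_sumType /= [X in _ + X]big1 ?addr0; last first.
    by move=> ? _; rewrite ffunE mul0r.
  apply: ler_sum => x _; rewrite ffunE /g mulrDl; apply: lerD.
    case wxy: (w (x, y)); last by rewrite fw ?wxy // mul0r.
    by rewrite ler_piMr // (ler_nat _ _ 1) dist_adj.
  rewrite [leRHS]mulrC; have [way|nay] := boolP (w (a, y)); last first.
    (* Residual mass sits only on neighbours of [a], as [mu] vanishes elsewhere. *)
    have -> : rY y = 0.
      apply/eqP; rewrite eq_le rY0 andbT /rY (negbTE nay) mul0r sub0r.
      by rewrite oppr_le0 sumr_ge0.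
    by rewrite !mul0r.
  have [wxb|nxb] := boolP (w (x, b)); last first.
    have -> : rX x = 0.
      apply/eqP; rewrite eq_le rX0 andbT /rX (negbTE nxb) mul0r sub0r.
      by rewrite oppr_le0 sumr_ge0.
    by rewrite !(mul0r, mulr0).
  by rewrite ler_wpM2l // ler_nat (dist_path3 wab).
under eq_bigr do rewrite big_split /= -mulr_sumr -mulr_sumr -mulr_suml srX rYV.
rewrite big_split /= -mulr_sumr srY -/M; lra.
Qed.

(** The set of costs must be nonempty before its infimum can be bounded from below. The zero partial
    plan yields the product coupling. *)
Lemma has_coupling : exists pi : {ffun vert m * vert m -> R},
  coupling (unif_nbhd w (inl a)) (unif_nbhd w (inr b)) pi.
Proof.
have [||||pi [cpi _]] := @coupling_of_partial (fun _ _ => 0) => //.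
- by move=> y; rewrite big1 // mu_ge0.
- by move=> x; rewrite big1 // nu_ge0.
by exists pi.
Qed.

(** With [M] the mass of [f], the completed coupling costs at most [3 - 2 * M], and one minus this
    is [-2 * (1 - M)]. *)
Lemma kappa_ge (f : 'I_m.+1 -> 'I_m.+1 -> R) :
  (forall y x, 0 <= f y x) -> (forall y x, ~~ w (x, y) -> f y x = 0) ->
  (forall y, \sum_x f y x <= mu y) -> (forall x, \sum_y f y x <= nu x) ->
  -2 * (1 - \sum_y \sum_x f y x) <= kappa a b w.
Proof.
move=> f0 fw fmu fnu; have [pi [cpi le_pi]] := coupling_of_partial f0 fw fmu fnu.
rewrite /kappa /ricci /W1; set A := [set c : R | _].
have : inf A <= \sum_z pi z * (dist w z.1 z.2)%:R.
  apply: ge_inf; last by exists pi.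
  exists 0 => _ [pi' [[pi0 _ _] ->]]; apply: sumr_ge0 => z _.
  by rewrite mulr_ge0.
lra.
Qed.

(* Weak Kantorovich duality, with potentials [phi] and [psi]. *)
Lemma kappa_le (phi psi : 'I_m.+1 -> R) :
  (forall y x, w (a, y) -> w (x, b) ->
     phi y + psi x <= (dist w (inr y) (inl x))%:R) ->
  kappa a b w <= 1 - (\sum_y mu y * phi y + \sum_x nu x * psi x).
Proof.
move=> phipsi; rewrite /kappa /ricci lerD2l lerN2; apply: lb_le_inf.
  have [pi cpi] := has_coupling.
  by exists (\sum_z pi z * (dist w z.1 z.2)%:R); exists pi.
move=> _ [pi [[pi0 piY piX] ->]].
(* The marginals of [pi] force its mass onto pairs [(inr y, inl x)]; all other entries in the row of
   [inr y] vanish. *)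
have sY : \sum_y mu y * phi y = \sum_y \sum_x pi (inr y, inl x) * phi y.
  apply: eq_bigr => y _; rewrite -mulr_suml; congr (_ * _).
  have := piY (inr y); rewrite unif_nbhd_inl big_sumType /= [X in _ + X]big1 ?addr0 //.
  move=> z _; have := piX (inr z); rewrite unif_nbhd_inr => /eqP.
  by rewrite psumr_eq0 // => /allP /(_ (inr y)); rewrite mem_index_enum => /(_ isT) /eqP.
have sX : \sum_x nu x * psi x = \sum_y \sum_x pi (inr y, inl x) * psi x.
  rewrite exchange_big /=; apply: eq_bigr => x _; rewrite -mulr_suml; congr (_ * _).
  have := piX (inl x); rewrite unif_nbhd_inr big_sumType /= [X in X + _]big1 ?add0r //.
  move=> z _; have := piY (inl z); rewrite unif_nbhd_inl => /eqP.
  by rewrite psumr_eq0 // => /allP /(_ (inl x)); rewrite mem_index_enum => /(_ isT) /eqP.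
rewrite sY sX -big_split /=.
rewrite cost_pair.
rewrite big_sumType /= -[leLHS]add0r; apply: lerD.
  by apply: sumr_ge0 => ? _; apply: sumr_ge0 => ? _; rewrite mulr_ge0.
apply: ler_sum => y _; rewrite big_sumType /= -big_split -[leLHS]addr0.
apply: lerD; last by apply: sumr_ge0 => ? _; rewrite mulr_ge0.
apply: ler_sum => x _; rewrite /= -mulrDr.
(* The potentials are constrained only on the two neighbourhoods; outside them [pi] has no mass. *)
have [way|nay] := boolP (w (a, y)); last first.
  have := piY (inr y); rewrite unif_nbhd_inl (negbTE nay) mul0r => /eqP.
  rewrite psumr_eq0 // => /allP /(_ (inl x)); rewrite mem_index_enum => /(_ isT) /eqP ->.
  by rewrite !mul0r.
have [wxb|nxb] := boolP (w (x, b)); last first.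
  have := piX (inl x); rewrite unif_nbhd_inr (negbTE nxb) mul0r => /eqP.
  rewrite psumr_eq0 // => /allP /(_ (inr y)); rewrite mem_index_enum => /(_ isT) /eqP ->.
  by rewrite !mul0r.
by rewrite ler_wpM2l // phipsi.
Qed.

(** Neighbours of [a] and of [b] lie on opposite sides, so all mass travels distance at least 1:
    take the potentials 1 and 0. *)
Lemma kappa_le0 : kappa a b w <= 0 :> R.
Proof.
apply: le_trans (@kappa_le (fun=> 1) (fun=> 0) _) _.
  by move=> y x _ _; rewrite addr0 (ler_nat _ 1) dist_ge1.
by rewrite -mulr_suml sum_mu -mulr_suml; lra.
Qed.

Lemma kappa_geN2 : -2 <= kappa a b w :> R.
Proof.
apply: le_trans (@kappa_ge (fun _ _ => 0) _ _ _ _) => //.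
- by rewrite big1 => [|y _]; [lra|rewrite big1].
- by move=> y; rewrite big1 // mu_ge0.
- by move=> x; rewrite big1 // nu_ge0.
Qed.

(* For a neighbour [y] of [a], the number of 4-cycles [a b x y]. *)
Definition cycles4 (y : 'I_m.+1) : R :=
  \sum_(x | x != a) (w (x, b))%:R * (w (x, y))%:R.

Lemma cycles4_ge0 y : 0 <= cycles4 y.
Proof. by apply: sumr_ge0 => x _; rewrite mulr_ge0. Qed.

(** Mass moves along edges in three ways: out of [b], of mass [da^-1]; into [a], of mass [db^-1]; or
    between the endpoints [y], [x] of a 4-cycle through the edge. *)
Lemma kappa_le_cycles4 :
  kappa a b w <= -2 * (1 - da^-1 - db^-1 - \sum_(y | y != b) mu y * cycles4 y).
Proof.
(* Starting from the generic cost 3, [phi] is lowered by 2 at [b] and by at least 2 at each [y] on a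
   4-cycle, and [psi] is lowered by 2 at [a]: exactly where cost 1 is possible. *)
pose phi y : R := 3 - 2 * (if y == b then 1 else cycles4 y).
pose psi x : R := -2 * (x == a)%:R.
apply: le_trans (@kappa_le phi psi _) _.
  move=> y x way wxb; rewrite /phi /psi.
  have d1 : 1 <= (dist w (inr y) (inl x))%:R :> R by rewrite (ler_nat _ 1) dist_ge1.
  have c0 := cycles4_ge0 y.
  have [xa|xa] := eqVneq x a.
    by rewrite /=; case: ifP => _; lra.
  have [yb|yb] := eqVneq y b; first by rewrite /=; lra.
  have [wxy|nxy] := boolP (w (x, y)).
    have : 1 <= cycles4 y.
      rewrite /cycles4 (bigD1 x) //= wxb wxy mulr1 lerDl.
      by apply: sumr_ge0 => ? _; rewrite mulr_ge0.
    by rewrite /=; lra.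
  (* Two distinct left vertices [x] and [a] rule out the one-vertex parts. *)
  have m0 : (0 < m)%N.
    by move: xa; clear; case: m x a => // x a'; rewrite !ord1 eqxx.
  have : 3 <= (dist w (inr y) (inl x))%:R :> R by rewrite (ler_nat _ 3) dist_ge3.
  by rewrite /=; lra.
have -> : \sum_x nu x * psi x = -2 * db^-1.
  rewrite (bigD1 a) //= wab /psi eqxx big1; first by rewrite /=; ring.
  by move=> x /negbTE ->; rewrite !mulr0.
have -> : \sum_y mu y * phi y = 3 - 2 * (da^-1 + \sum_(y | y != b) mu y * cycles4 y).
  rewrite /phi; under eq_bigr do rewrite mulrBr [X in _ - X]mulrCA.
  rewrite sumrB -mulr_suml sum_mu mul1r -mulr_sumr (bigD1 b) //= eqxx wab.
  rewrite mulr1 mul1r; congr (_ - _ * (_ + _)).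
  by apply: eq_bigr => y /negbTE ->.
by lra.
Qed.

End Transport.

(** * Curvature bounds for a fixed graph *)

Section Bounds.
Variables (R : realType) (m : nat) (a b : 'I_m.+1) (w : config m).
Hypothesis wab : w (a, b).

Local Notation nA := #|nbrsA a b w|.
Local Notation nB := #|nbrsB a b w|.
Local Notation da := (1 + nA%:R : R).
Local Notation db := (1 + nB%:R : R).
Local Notation mu := (fun y => (w (a, y))%:R / da).
Local Notation nu := (fun x => (w (x, b))%:R / db).

(** Using only the edges at [a] and [b], either everything can be moved at cost 1, when one endpoint
    is a leaf, or the mass at [b] is sent out and the mass required at [a] is brought in. *)
Lemma kappa_ge_inv_degrees : -2 * (1 - da^-1 - db^-1) <= kappa a b w \/ 0 <= kappa a b w :> R.
Proof.
have da0 : 0 < da := da_gt0 R a b w; have db0 : 0 < db := db_gt0 R a b w.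
have [A0|A0] := posnP nA.
  (* Here [m_a] is the point mass at [b], which is adjacent to the whole support of [m_b]. *)
  right; apply: le_trans (@kappa_ge R m a b w wab
    (fun y x => (y == b)%:R * nu x) _ _ _ _).
  - rewrite (bigD1 b) //= eqxx [X in 1 - (_ + X)]big1 => [|y /negbTE ->].
      by under eq_bigr do rewrite mul1r; rewrite (sum_nu R wab); lra.
    by rewrite big1 // => x _; rewrite mul0r.
  - by move=> y x; rewrite mulr_ge0 // nu_ge0.
  - by move=> y x; case: eqVneq => [->|] /=; [move/negbTE ->|]; rewrite !mul0r ?mulr0.
  - move=> y; rewrite -mulr_sumr (sum_nu R wab) mulr1.
    case: eqVneq => [->|_]; last exact: mu_ge0.
    by rewrite wab A0 addr0 divr1.
  - move=> x; rewrite (bigD1 b) //= eqxx mul1r big1 ?addr0 // => y /negbTE ->.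
    by rewrite mul0r.
have [B0|B0] := posnP nB.
  right; apply: le_trans (@kappa_ge R m a b w wab
    (fun y x => (x == a)%:R * mu y) _ _ _ _).
  - under eq_bigr => y _.
      rewrite (bigD1 a) //= eqxx mul1r big1 ?addr0; last first.
        by move=> x /negbTE ->; rewrite mul0r.
      over.
    by rewrite (sum_mu R wab); lra.
  - by move=> y x; rewrite mulr_ge0 // mu_ge0.
  - by move=> y x; case: eqVneq => [->|] /=; [move/negbTE ->|]; rewrite !mul0r ?mulr0.
  - move=> y; rewrite (bigD1 a) //= eqxx mul1r big1 ?addr0 // => x /negbTE ->.
    by rewrite mul0r.
  - move=> x; rewrite -mulr_sumr (sum_mu R wab) mulr1.
    case: eqVneq => [->|_]; last exact: nu_ge0.
    by rewrite wab B0 addr0 divr1.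
left.
have A1 : 1 <= nA%:R :> R by rewrite (ler_nat _ 1).
have B1 : 1 <= nB%:R :> R by rewrite (ler_nat _ 1).
(* The mass [da^-1] at [b] is spread evenly over [nbrsB], and the mass [db^-1] due at [a] is taken
   evenly from [nbrsA]. *)
pose f y x : R := (y == b)%:R * ((x != a)%:R * (w (x, b))%:R / (da * nB%:R)) +
                  (x == a)%:R * ((y != b)%:R * (w (a, y))%:R / (db * nA%:R)).
have sB : \sum_x (x != a)%:R * (w (x, b))%:R = nB%:R :> R.
  rewrite nbrsB_sum [RHS]big_mkcond; apply: eq_bigr => x _.
  by case: (x != a); rewrite ?mul1r ?mul0r.
have sA : \sum_y (y != b)%:R * (w (a, y))%:R = nA%:R :> R.
  rewrite nbrsA_sum [RHS]big_mkcond; apply: eq_bigr => y _.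
  by case: (y != b); rewrite ?mul1r ?mul0r.
have delta (I : finType) (i0 : I) : \sum_i (i == i0)%:R = 1 :> R.
  by rewrite (bigD1 i0) //= eqxx big1 ?addr0 // => i /negbTE ->.
have fY y : \sum_x f y x = (y == b)%:R / da + (y != b)%:R * (w (a, y))%:R / (db * nA%:R).
  rewrite big_split /= -mulr_sumr -mulr_suml sB -mulr_suml delta.
  by rewrite mul1r; congr (_ * _ + _); field; lra.
have fX x : \sum_y f y x = (x != a)%:R * (w (x, b))%:R / (da * nB%:R) + (x == a)%:R / db.
  rewrite big_split /= -mulr_suml delta -mulr_sumr -mulr_suml sA mul1r.
  by congr (_ + _ * _); field; lra.
apply: le_trans (@kappa_ge R m a b w wab f _ _ _ _).
- under eq_bigr do rewrite fY.
  rewrite big_split /= -!mulr_suml delta sA.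
  have -> : nA%:R / (db * nA%:R) = db^-1 by field; lra.
  by lra.
- by move=> y x; rewrite addr_ge0 // !mulr_ge0 // invr_ge0 mulr_ge0 // ltW.
- move=> y x nxy; rewrite /f.
  case: eqVneq => [yb|yb]; case: eqVneq => [xa|xa]; rewrite ?(mul0r, mulr0, addr0, add0r) //.
  + by rewrite -yb (negbTE nxy) !(mul0r, mulr0).
  + by rewrite -xa (negbTE nxy) !(mul0r, mulr0).
- move=> y; rewrite fY; case: eqVneq => [->|yb] /=.
    by rewrite wab !mul0r addr0.
  (* What remains is [da <= db * nA], true because both [nA] and [nB] are at least 1. *)
  rewrite mul0r add0r mul1r ler_wpM2l // lef_pV2 ?posrE ?mulr_gt0 //; last lra.
  by nra.
- move=> x; rewrite fX; case: eqVneq => [->|xa] /=.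
    by rewrite wab !mul0r add0r.
  rewrite mul0r addr0 mul1r ler_wpM2l // lef_pV2 ?posrE ?mulr_gt0 //; last lra.
  by nra.
Qed.

(** The upper bound through 4-cycles meets the lower bound through degrees; the positive part in
    [limit_fun] comes from [kappa <= 0] on one side and the leaf case on the other. *)
Lemma kappa_no_cycles4 :
  (forall y, y != b -> w (a, y) -> cycles4 R a b w y = 0) ->
  kappa a b w = limit_fun nA nB :> R.
Proof.
move=> c0; rewrite /limit_fun; set t := 1 - _ - _.
have k0 := kappa_le0 R wab; have kc := kappa_le_cycles4 R wab.
rewrite big1 ?subr0 -/t in kc; last first.
  move=> y yb; case way: (w (a, y)); last by rewrite !mul0r.
  by rewrite c0 ?mulr0.
have kg := kappa_ge_inv_degrees; rewrite -/t in kg.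
by apply/eqP; rewrite eq_le; apply/andP; split; case: (leP t 0) kg => ? []; lra.
Qed.

(* Scaling [f] down along rows and columns makes its marginals admissible, at a
   cost bounded by their [L1] errors. *)
Lemma kappa_ge_approx (f : 'I_m.+1 -> 'I_m.+1 -> R) :
  (forall y x, 0 <= f y x) -> (forall y x, ~~ w (x, y) -> f y x = 0) ->
  -2 * (2 * \sum_y `|\sum_x f y x - mu y| + \sum_x `|\sum_y f y x - nu x|)
    <= kappa a b w.
Proof.
move=> f0 fw; set LY := \sum_y _; set LX := \sum_x _.
pose fY y := \sum_x f y x; pose fX x := \sum_y f y x.
(* The largest factor in [[0, 1]] that brings a marginal [c] down to [d]. *)
pose scale (c d : R) : R := if c <= d then 1 else d / c.
have scaleP (c d : R) : 0 <= c -> 0 <= d ->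
    [/\ 0 <= scale c d <= 1, scale c d * c <= d & (1 - scale c d) * c <= `|c - d|].
  move=> c0 d0; rewrite /scale; case: (leP c d) => cd; first split.
  - by rewrite ler01 lexx.
  - by rewrite mul1r.
  - by rewrite subrr mul0r.
  have c1 : 0 < c by lra.
  split.
  - by rewrite divr_ge0 //= ler_pdivrMr // mul1r ltW.
  - by rewrite divfK ?gt_eqF.
  - by rewrite mulrBl divfK ?gt_eqF // mul1r ler_norm.
have fY0 y : 0 <= fY y by apply: sumr_ge0.
have fX0 x : 0 <= fX x by apply: sumr_ge0.
pose al y := scale (fY y) (mu y); pose be x := scale (fX x) (nu x).
have alP y := scaleP (fY y) (mu y) (fY0 y) (mu_ge0 R a b w y).
have beP x := scaleP (fX x) (nu x) (fX0 x) (nu_ge0 R a b w x).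
have al0 y : 0 <= al y by have [/andP[]] := alP y.
have be0 x : 0 <= be x by have [/andP[]] := beP x.
have al1 y : al y <= 1 by have [/andP[]] := alP y.
have be1 x : be x <= 1 by have [/andP[]] := beP x.
pose g y x := f y x * al y * be x.
apply: le_trans (@kappa_ge R m a b w wab g _ _ _ _).
- rewrite ler_nM2l; last lra.
  (* Union bound for the loss: the row and column losses are subtracted separately, with error
     [(1 - al y) * (1 - be x) >= 0]. *)
  have low : \sum_y \sum_x (f y x - (1 - al y) * f y x - (1 - be x) * f y x)
      <= \sum_y \sum_x g y x.
    apply: ler_sum => y _; apply: ler_sum => x _; rewrite -subr_ge0 /g.
    have -> : f y x * al y * be x - (f y x - (1 - al y) * f y x - (1 - be x) * f y x)
      = f y x * ((1 - al y) * (1 - be x)) by ring.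
    by rewrite !mulr_ge0 // subr_ge0.
  have split3 : \sum_y \sum_x (f y x - (1 - al y) * f y x - (1 - be x) * f y x)
      = \sum_y fY y - \sum_y (1 - al y) * fY y - \sum_x (1 - be x) * fX x.
    under eq_bigr do rewrite !sumrB -mulr_sumr.
    rewrite !sumrB; congr (_ - _); rewrite exchange_big /=.
    by apply: eq_bigr => x _; rewrite mulr_sumr.
  have hY : \sum_y (1 - al y) * fY y <= LY.
    by apply: ler_sum => y _; have [] := alP y.
  have hX : \sum_x (1 - be x) * fX x <= LX.
    by apply: ler_sum => x _; have [] := beP x.
  (* The second use of [LY], which explains the factor 2: the total mass of [f] may itself fall
     short of 1. *)
  have hm : \sum_y mu y - LY <= \sum_y fY y.
    rewrite lerBlDr -big_split; apply: ler_sum => y _ /=; rewrite -lerBlDl.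
    by rewrite -normrN opprB ler_norm.
  by rewrite (sum_mu R wab) in hm; lra.
- by move=> y x; rewrite !mulr_ge0.
- by move=> y x nxy; rewrite /g fw // !mul0r.
- move=> y; have [_ le_mu _] := alP y; apply: le_trans le_mu.
  rewrite mulr_sumr; apply: ler_sum => x _; rewrite /g [X in X * _]mulrC.
  by rewrite ler_piMr // mulr_ge0.
- move=> x; have [_ le_nu _] := beP x; apply: le_trans le_nu.
  rewrite mulr_sumr; apply: ler_sum => y _; rewrite /g [leLHS]mulrC.
  by rewrite ler_wpM2l // ler_piMr.
Qed.

End Bounds.

(* Either [D >= t / 2], or the deviation [|D / t - 1|] exceeds [1 / 2]. *)
Lemma inv1D_le (R : realType) (D t : R) : 0 <= D -> 0 < t ->
  (1 + D)^-1 <= 2 / t + 2 * `|D / t - 1|.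
Proof.
move=> D0 t0; have [Dt|Dt] := leP (t / 2) D.
  rewrite -[leLHS]addr0; apply: lerD; last by rewrite mulr_ge0.
  by rewrite -[2 / t]invrK invf_div lef_pV2 ?posrE; lra.
have t_ge : 0 <= 2 / t by rewrite divr_ge0 // ltW.
have le1 : (1 + D)^-1 <= 1 by rewrite invf_le1; lra.
have : D / t < 1 / 2 by rewrite ltr_pdivrMr //; lra.
by move=> ?; rewrite ltr0_norm; lra.
Qed.

(** Three errors add up: the mass missing at [i0], the replacement of [c i / s] by 1, and that of
    [t^-1] by [(1 + D)^-1]. The first and third together cost [|D / t - 1|] plus twice [(1 + D)^-1],
    whence the constants 4 and 5. *)
Lemma approx_marginal (R : realType) (I : finType) (i0 : I) (z : I -> bool)
    (c : I -> R) (t s D : R) : z i0 -> 0 < t -> D = \sum_(i | i != i0) (z i)%:R ->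
  \sum_i `|(i != i0)%:R * (z i)%:R / t * (c i / s) - (z i)%:R / (1 + D)| <=
  4 / t + 5 * `|D / t - 1| + \sum_(i | i != i0) (z i)%:R / t * `|c i / s - 1|.
Proof.
move=> z0 t0 DE.
have D0 : 0 <= D by rewrite DE sumr_ge0.
have inv0 : 0 < (1 + D)^-1 by rewrite invr_gt0; lra.
rewrite (bigD1 i0) //= eqxx z0 !mul0r sub0r normrN mul1r gtr0_norm //.
have step : \sum_(i | i != i0)
      `|(i != i0)%:R * (z i)%:R / t * (c i / s) - (z i)%:R / (1 + D)| <=
    \sum_(i | i != i0) (z i)%:R / t * `|c i / s - 1| +
    \sum_(i | i != i0) (z i)%:R * `|t^-1 - (1 + D)^-1|.
  rewrite -big_split; apply: ler_sum => i -> /=; rewrite mul1r.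
  have -> : (z i)%:R / t * (c i / s) - (z i)%:R / (1 + D)
    = (z i)%:R / t * (c i / s - 1) + (z i)%:R * (t^-1 - (1 + D)^-1) by ring.
  apply: le_trans (ler_normD _ _) _; rewrite !normrM normr_nat.
  by rewrite (gtr0_norm (x := t^-1)) ?invr_gt0.
rewrite -mulr_suml -DE in step.
have last_term : D * `|t^-1 - (1 + D)^-1| <= `|D / t - 1| + (1 + D)^-1.
  rewrite -[X in X * _](ger0_norm D0) -normrM.
  have -> : D * (t^-1 - (1 + D)^-1) = (D / t - 1) + (1 + D)^-1 by field; lra.
  by apply: le_trans (ler_normD _ _) _; rewrite [X in _ + X]gtr0_norm.
have := inv1D_le D0 t0; lra.
Qed.

(** * Moment bounds *)

Section Moments.
Variables (R : realType) (m : nat) (p : R) (a b : 'I_m.+1).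
Hypothesis p01 : 0 <= p <= 1.
Hypothesis p_gt0 : 0 < p.
Hypothesis m_gt0 : (0 < m)%N.

Local Notation edge := ('I_m.+1 * 'I_m.+1)%type.
Local Notation E := (cond_expect p a b).
Local Notation t := (m%:R * p).
Local Notation s := (m%:R * p ^+ 2).

Lemma edges_present_ge0 (S : {set edge}) w : 0 <= edges_present R S w.
Proof. by apply: prodr_ge0 => e _. Qed.

(** Given [T], the sum is binomial with mean [q = #|J| * p ^+ k], so its relative variance is
    [(1 - p ^+ k) / q], at most [q^-1]. *)
Lemma cond_expect_deviation (I : finType) (J : {set I}) (S : I -> {set edge})
    (T : {set edge}) (k : nat) :
  (0 < #|J|)%N -> (a, b) \notin T ->
  (forall i, i \in J ->
     [/\ (a, b) \notin S i, #|S i| = k & T :&: S i = finset.set0]) ->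
  (forall i j, i \in J -> j \in J -> i != j -> S i :&: S j = finset.set0) ->
  E (fun w => edges_present R T w *
       `|(\sum_(i in J) edges_present R (S i) w) / (#|J|%:R * p ^+ k) - 1|) <=
  p ^+ #|T| * Num.sqrt (#|J|%:R * p ^+ k)^-1.
Proof.
move=> J0 abT SP Sdisj; set q := #|J|%:R * p ^+ k.
have q0 : 0 < q by rewrite mulr_gt0 ?exprn_gt0 // ltr0n.
have pT0 : 0 < p ^+ #|T| by rewrite exprn_gt0.
pose X w := (\sum_(i in J) edges_present R (S i) w) / q - 1.
(* Dividing by [p ^+ #|T|] turns the indicator of [T] into a density of expectation 1. *)
rewrite -ler_pdivrMl //.
have -> : (p ^+ #|T|)^-1 * E (fun w => edges_present R T w * `|X w|) =
    E (fun w => ((p ^+ #|T|)^-1 * edges_present R T w) * `|X w|).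
  by rewrite -cond_expectZ; apply: eq_cond_expect => // w _; rewrite mulrA.
apply: cond_expect_abs => //.
- by move=> w; rewrite mulr_ge0 ?edges_present_ge0 // invr_ge0 ltW.
- by rewrite invr_gt0.
- by rewrite cond_expectZ cond_expect_edges // mulVf // gt_eqF.
have -> : E (fun w => ((p ^+ #|T|)^-1 * edges_present R T w) * X w ^+ 2) =
    (p ^+ #|T|)^-1 * q ^- 2 * E (fun w => edges_present R T w *
      (\sum_(i in J) edges_present R (S i) w - q) ^+ 2).
  rewrite -cond_expectZ; apply: eq_cond_expect => // w _; rewrite /X.
  by field; rewrite !gt_eqF.
rewrite (cond_expect_variance p01 abT SP Sdisj).
have -> : (p ^+ #|T|)^-1 * q ^- 2 * (p ^+ #|T| * (#|J|%:R * (p ^+ k * (1 - p ^+ k))))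
    = q^-1 * (1 - p ^+ k) by rewrite /q; field; rewrite !gt_eqF ?ltr0n ?exprn_gt0.
apply: ler_piMr; first by rewrite invr_ge0 ltW.
by rewrite lerBlDr lerDl exprn_ge0 // ltW.
Qed.

Lemma cond_expect_devA :
  E (fun w => `|#|nbrsA a b w|%:R / t - 1|) <= Num.sqrt t^-1.
Proof.
have := @cond_expect_deviation _ [set~ b]%SET (fun y => [set (a, y)]%SET) finset.set0 1.
rewrite cardsC1 card_ord /= cards0 expr0 mul1r expr1 => /(_ m_gt0).
move=> H; apply: le_trans (H _ _ _).
- apply: le_cond_expect => // w _; rewrite edges_present0 mul1r nbrsA_sum.
  rewrite le_eqVlt; apply/orP; left; apply/eqP; congr (`|_ / _ - _|).
  by apply: eq_big => [y|y _]; rewrite ?inE // edges_present1.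
- by rewrite inE.
- move=> y; rewrite !inE => yb; split; rewrite ?cards1 ?finset.set0I //.
  by rewrite ?inE xpair_eqE eqxx eq_sym.
- move=> y y' _ _ yy'; apply/setP => -[u v]; rewrite !inE !xpair_eqE.
  by apply/negbTE/negP => /andP[/andP[_ /eqP->] /andP[_ /eqP vy]]; rewrite vy eqxx in yy'.
Qed.

Lemma cond_expect_devB :
  E (fun w => `|#|nbrsB a b w|%:R / t - 1|) <= Num.sqrt t^-1.
Proof.
have := @cond_expect_deviation _ [set~ a]%SET (fun x => [set (x, b)]%SET) finset.set0 1.
rewrite cardsC1 card_ord /= cards0 expr0 mul1r expr1 => /(_ m_gt0).
move=> H; apply: le_trans (H _ _ _).
- apply: le_cond_expect => // w _; rewrite edges_present0 mul1r nbrsB_sum.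
  rewrite le_eqVlt; apply/orP; left; apply/eqP; congr (`|_ / _ - _|).
  by apply: eq_big => [y|y _]; rewrite ?inE // edges_present1.
- by rewrite inE.
- move=> y; rewrite !inE => yb; split; rewrite ?cards1 ?finset.set0I //.
  by rewrite ?inE xpair_eqE eqxx andbT eq_sym.
- move=> y y' _ _ yy'; apply/setP => -[u v]; rewrite !inE !xpair_eqE.
  by apply/negbTE/negP => /andP[/andP[/eqP-> _] /andP[/eqP vy _]]; rewrite vy eqxx in yy'.
Qed.

Lemma edges_present2 (e e' : edge) w :
  edges_present R [set e; e']%SET w = (w e)%:R * (w e')%:R.
Proof. by rewrite edges_presentU !edges_present1. Qed.

(** Here [T] is the edge [(a, y)], and each [x] contributes the path of two edges from [b] to [y];
    these paths are edge-disjoint. *)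
Lemma cond_expect_devY (y : 'I_m.+1) : y != b ->
  E (fun w => (w (a, y))%:R * `|cycles4 R a b w y / s - 1|) <= p * Num.sqrt s^-1.
Proof.
move=> yb.
have := @cond_expect_deviation _ [set~ a]%SET
  (fun x => [set (x, b); (x, y)]%SET) [set (a, y)]%SET 2.
rewrite cardsC1 card_ord /= cards1 expr1 => /(_ m_gt0).
move=> H; apply: le_trans (H _ _ _).
- apply: le_cond_expect => // w _; rewrite edges_present1 /cycles4.
  rewrite le_eqVlt; apply/orP; left; apply/eqP; congr (_ * `|_ / _ - _|).
  by apply: eq_big => [x|x _]; rewrite ?inE // edges_present2.
- by rewrite inE xpair_eqE eqxx eq_sym.
- move=> x; rewrite !inE => xa; split.
  + by rewrite ?inE !xpair_eqE eq_sym (negbTE xa).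
  + by rewrite cards2 xpair_eqE eqxx eq_sym yb.
  + apply/setP => -[u v]; rewrite !inE !xpair_eqE.
    by case: eqVneq => //= ->; rewrite ![a == x]eq_sym (negbTE xa) andbF.
- move=> x x' _ _ xx'; apply/setP => -[u v]; rewrite !inE !xpair_eqE.
  by case: (eqVneq u x) => //= ->; rewrite (negbTE xx') andbF.
Qed.

(** The mirror image of [cycles4], counting the 4-cycles from their vertex [x] next to [b]. *)
Definition cycles4' (w : config m) (x : 'I_m.+1) : R :=
  \sum_(y | y != b) (w (a, y))%:R * (w (x, y))%:R.

Lemma cond_expect_devX (x : 'I_m.+1) : x != a ->
  E (fun w => (w (x, b))%:R * `|cycles4' w x / s - 1|) <= p * Num.sqrt s^-1.
Proof.
move=> xa.
have := @cond_expect_deviation _ [set~ b]%SET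
  (fun y => [set (a, y); (x, y)]%SET) [set (x, b)]%SET 2.
rewrite cardsC1 card_ord /= cards1 expr1 => /(_ m_gt0).
move=> H; apply: le_trans (H _ _ _).
- apply: le_cond_expect => // w _; rewrite edges_present1 /cycles4'.
  rewrite le_eqVlt; apply/orP; left; apply/eqP; congr (_ * `|_ / _ - _|).
  by apply: eq_big => [y|y _]; rewrite ?inE // edges_present2.
- by rewrite inE xpair_eqE eqxx andbT eq_sym.
- move=> y; rewrite !inE => yb; split.
  + by rewrite ?inE !xpair_eqE [b == y]eq_sym (negbTE yb) !andbF.
  + by rewrite cards2 xpair_eqE eqxx andbT eq_sym xa.
  + apply/setP => -[u v]; rewrite !inE !xpair_eqE.
    case: (eqVneq v b) => [->|_] /=; last by rewrite andbF.
    by rewrite [b == y]eq_sym (negbTE yb) !andbF.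
- move=> y y' _ _ yy'; apply/setP => -[u v]; rewrite !inE !xpair_eqE.
  case: (eqVneq v y) => [->|_] /=; last by rewrite !andbF.
  by rewrite (negbTE yy') !andbF.
Qed.

Lemma sum_neq_cst (i0 : 'I_m.+1) (c : R) : \sum_(i | i != i0) c = m%:R * c.
Proof.
rewrite sumr_const mulr_natl; congr (_ *+ _).
by have := cardC1 i0; rewrite card_ord.
Qed.

(** There are [m ^ 2] possible 4-cycles through the forced edge, each with three further edges, and
    [m ^ 2 * p ^ 3] is [t * s]. *)
Lemma cond_expect_count_cycles4 :
  E (fun w => \sum_(y | y != b) (w (a, y))%:R * cycles4 R a b w y) = t * s.
Proof.
rewrite cond_expect_sum (eq_bigr (fun=> m%:R * p ^+ 3)); last first.
  move=> y yb; rewrite /cycles4.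
  rewrite (_ : E _ = \sum_(x | x != a)
      E (edges_present R [set (a, y); (x, b); (x, y)]%SET)); last first.
    rewrite -cond_expect_sum; apply: eq_cond_expect => // w _; rewrite mulr_sumr.
    apply: eq_bigr => x xa; rewrite mulrA !edges_presentU !edges_present1 //.
  rewrite (eq_bigr (fun=> p ^+ 3)) ?sum_neq_cst // => x xa.
  rewrite cond_expect_edges //; last first.
    by rewrite !inE !xpair_eqE eqxx ![a == x]eq_sym (negbTE xa) [b == y]eq_sym (negbTE yb).
  rewrite -finset.setUA cardsU1 cards2 !inE !xpair_eqE eqxx [b == y]eq_sym.
  by rewrite [a == x]eq_sym (negbTE xa) (negbTE yb) !andbF.
by rewrite sum_neq_cst; ring.
Qed.

Lemma meanp_gt0 : 0 < t. Proof. by rewrite mulr_gt0 ?ltr0n. Qed.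
Lemma meanp2_gt0 : 0 < s. Proof. by rewrite mulr_gt0 ?exprn_gt0 ?ltr0n. Qed.

Lemma kappaD2_le (w : config m) : w (a, b) ->
  `|kappa a b w - (-2)| <= 8 / t + 8 * `|#|nbrsA a b w|%:R / t - 1|
    + 4 * `|#|nbrsB a b w|%:R / t - 1|
    + 4 / t * \sum_(y | y != b) (w (a, y))%:R * cycles4 R a b w y.
Proof.
move=> wab; have t0 := meanp_gt0.
have k2 := kappa_geN2 R wab; have k0 := kappa_le0 R wab.
have kc := kappa_le_cycles4 R wab.
rewrite ger0_norm ?subr_ge0 //.
have A0 : 0 <= #|nbrsA a b w|%:R :> R by [].
have B0 : 0 <= #|nbrsB a b w|%:R :> R by [].
set A := #|nbrsA a b w|%:R in kc A0 *; set B := #|nbrsB a b w|%:R in kc B0 *.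
set C := \sum_(y | y != b) (w (a, y))%:R * cycles4 R a b w y.
have iA := inv1D_le A0 t0; have iB := inv1D_le B0 t0.
have C0 : 0 <= C by apply: sumr_ge0 => y _; rewrite mulr_ge0 // cycles4_ge0.
have tC0 : 0 <= 4 / t * C by rewrite mulr_ge0 // divr_ge0 // ltW.
have t4 : 0 <= 4 / t by rewrite divr_ge0 // ltW.
(* If [A >= t / 2], then [2 / t] bounds [(1 + A)^-1]. Otherwise the deviation of [A] exceeds 1/2,
   and its term alone exceeds the trivial bound 2. *)
have [At|At] := leP (t / 2) A.
  have hC : \sum_(y | y != b) (w (a, y))%:R / (1 + A) * cycles4 R a b w y <= 2 / t * C.
    rewrite /C mulr_sumr; apply: ler_sum => y _.
    rewrite [leRHS]mulrCA [leLHS]mulrAC -mulrA ler_wpM2l // mulrC.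
    rewrite ler_wpM2r ?cycles4_ge0 //.
    by rewrite -[2 / t]invrK invf_div lef_pV2 ?posrE; lra.
  by have := normr_ge0 (A / t - 1); lra.
have : A / t < 1 / 2 by rewrite ltr_pdivrMr //; lra.
move=> ?; have : 1 / 2 <= `|A / t - 1| by rewrite ltr0_norm; lra.
by have := normr_ge0 (B / t - 1); lra.
Qed.

Lemma cond_expect_kappaD2 :
  E (fun w => `|kappa a b w - (-2)|) <= 8 / t + 12 * Num.sqrt t^-1 + 4 * s.
Proof.
have t0 := meanp_gt0.
apply: le_trans (le_cond_expect p01 kappaD2_le) _.
rewrite !cond_expectD cond_expect_cst // !cond_expectZ cond_expect_count_cycles4.
have -> : 4 / t * (t * s) = 4 * s by field; rewrite !gt_eqF // ltr0n.
have := cond_expect_devA; have := cond_expect_devB; lra.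
Qed.

(** The flow [1 / (t * s)] on every edge between [nbrsA] and [nbrsB] goes through [kappa_ge_approx];
    the row errors count twice, the column errors once. *)
Lemma kappa_abs_le (w : config m) : w (a, b) ->
  `|kappa a b w| <= 2 * (3 * (4 / t) + 10 * `|#|nbrsA a b w|%:R / t - 1|
    + 5 * `|#|nbrsB a b w|%:R / t - 1|
    + 2 * \sum_(y | y != b) t^-1 * ((w (a, y))%:R * `|cycles4 R a b w y / s - 1|)
    + \sum_(x | x != a) t^-1 * ((w (x, b))%:R * `|cycles4' w x / s - 1|)).
Proof.
move=> wab; have t0 := meanp_gt0; have s0 := meanp2_gt0.
rewrite ler0_norm ?kappa_le0 //.
pose f y x : R := (y != b)%:R * (w (a, y))%:R / t *
  ((x != a)%:R * (w (x, b))%:R * (w (x, y))%:R / s).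
have fY y : \sum_x f y x = (y != b)%:R * (w (a, y))%:R / t * (cycles4 R a b w y / s).
  rewrite -mulr_sumr -mulr_suml; congr (_ * (_ / _)).
  rewrite /cycles4 [RHS]big_mkcond; apply: eq_bigr => x _.
  by case: (x != a); rewrite ?mul1r ?mul0r.
have fX x : \sum_y f y x = (x != a)%:R * (w (x, b))%:R / t * (cycles4' w x / s).
  rewrite /cycles4' mulr_suml mulr_sumr [RHS]big_mkcond; apply: eq_bigr => y _.
  by rewrite /f; case: (y != b) => /=; ring.
have /(_ f) := @kappa_ge_approx R m a b w wab.
have f0 y x : 0 <= f y x.
  by rewrite /f !mulr_ge0 // invr_ge0 ltW.
have fw y x : ~~ w (x, y) -> f y x = 0 by move=> /negbTE h; rewrite /f h /= !(mulr0, mul0r).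
move=> /(_ f0 fw).
under [\sum_y `|_|]eq_bigr do rewrite fY.
under [\sum_x `|_|]eq_bigr do rewrite fX.
have := @approx_marginal R _ b (fun y => w (a, y)) (cycles4 R a b w) t s _ wab t0
  (nbrsA_sum R a b w).
have := @approx_marginal R _ a (fun x => w (x, b)) (cycles4' w) t s _ wab t0
  (nbrsB_sum R a b w).
have -> : \sum_(y | y != b) t^-1 * ((w (a, y))%:R * `|cycles4 R a b w y / s - 1|)
  = \sum_(y | y != b) (w (a, y))%:R / t * `|cycles4 R a b w y / s - 1|.
  by apply: eq_bigr => y _; rewrite mulrA [X in X * _]mulrC.
have -> : \sum_(x | x != a) t^-1 * ((w (x, b))%:R * `|cycles4' w x / s - 1|)
  = \sum_(x | x != a) (w (x, b))%:R / t * `|cycles4' w x / s - 1|.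
  by apply: eq_bigr => y _; rewrite mulrA [X in X * _]mulrC.
lra.
Qed.

Lemma cond_expect_kappa :
  E (fun w => `|kappa a b w|) <= 24 / t + 30 * Num.sqrt t^-1 + 6 * Num.sqrt s^-1.
Proof.
have t0 := meanp_gt0.
apply: le_trans (le_cond_expect p01 kappa_abs_le) _.
rewrite cond_expectZ !cond_expectD cond_expect_cst // !cond_expectZ !cond_expect_sum.
(* The [m] summands are at most [p / t] times the square root, and [m * p / t = 1]. *)
have sY : \sum_(y | y != b)
    E (fun w => t^-1 * ((w (a, y))%:R * `|cycles4 R a b w y / s - 1|)) <= Num.sqrt s^-1.
  apply: (@le_trans _ _ (\sum_(y | y != b) t^-1 * (p * Num.sqrt s^-1))).
    apply: ler_sum => y yb; rewrite cond_expectZ ler_wpM2l ?cond_expect_devY //.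
    by rewrite invr_ge0 ltW.
  rewrite sum_neq_cst le_eqVlt; apply/orP; left; apply/eqP.
  by field; rewrite !gt_eqF // ltr0n.
have sX : \sum_(x | x != a)
    E (fun w => t^-1 * ((w (x, b))%:R * `|cycles4' w x / s - 1|)) <= Num.sqrt s^-1.
  apply: (@le_trans _ _ (\sum_(y | y != a) t^-1 * (p * Num.sqrt s^-1))).
    apply: ler_sum => y yb; rewrite cond_expectZ ler_wpM2l ?cond_expect_devX //.
    by rewrite invr_ge0 ltW.
  rewrite sum_neq_cst le_eqVlt; apply/orP; left; apply/eqP.
  by field; rewrite !gt_eqF // ltr0n.
have := cond_expect_devA; have := cond_expect_devB; lra.
Qed.

End Moments.

(** * The law of the two degrees *)

Section DegreeLaw.
Variables (R : realType) (m : nat) (p : R) (a b : 'I_m.+1).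
Hypothesis p01 : 0 <= p <= 1.

Local Notation edge := ('I_m.+1 * 'I_m.+1)%type.
Local Notation E := (cond_expect p a b).

Lemma cond_expect_nbrsA : E (fun w => #|nbrsA a b w|%:R) = m%:R * p.
Proof.
rewrite -(sum_neq_cst b).
transitivity (\sum_(y | y != b) E (edges_present R [set (a, y)]%SET)).
  rewrite -cond_expect_sum; apply: eq_cond_expect => // w _; rewrite nbrsA_sum.
  by apply: eq_bigr => y _; rewrite edges_present1.
apply: eq_bigr => y yb; rewrite cond_expect_edges ?cards1 ?expr1 //.
by rewrite inE xpair_eqE eqxx eq_sym.
Qed.

Lemma cond_expect_nbrsB : E (fun w => #|nbrsB a b w|%:R) = m%:R * p.
Proof.
rewrite -(sum_neq_cst a).
transitivity (\sum_(x | x != a) E (edges_present R [set (x, b)]%SET)).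
  rewrite -cond_expect_sum; apply: eq_cond_expect => // w _; rewrite nbrsB_sum.
  by apply: eq_bigr => y _; rewrite edges_present1.
apply: eq_bigr => y yb; rewrite cond_expect_edges ?cards1 ?expr1 //.
by rewrite inE xpair_eqE eqxx andbT eq_sym.
Qed.

Lemma prod_bool (I : finType) (B : pred I) :
  \prod_i (B i)%:R = [forall i, B i]%:R :> R.
Proof.
case: forallP => [Bi|nB]; first by rewrite big1 // => i _; rewrite Bi.
have /existsP[i /negbTE nBi] : [exists i, ~~ B i].
  by rewrite -negb_forall; apply/forallP.
by rewrite (bigD1 i) //= nBi mul0r.
Qed.

Lemma prod_neq_subset (i0 : 'I_m.+1) (S : {set 'I_m.+1}) : i0 \notin S ->
  \prod_(i | i != i0) (if i \in S then p else 1 - p)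
  = p ^+ #|S| * (1 - p) ^+ (m - #|S|).
Proof.
move=> i0S; rewrite (bigID (mem S)) /=; congr (_ * _).
  rewrite (eq_bigr (fun=> p)) => [|i /andP[_ ->] //].
  rewrite prodr_const; congr (_ ^+ _); apply: eq_card => i.
  rewrite -[LHS]/((i != i0) && (i \in S)) andbC.
  by case: (boolP (i \in S)) => //= iS; apply: contraNneq i0S => <-.
rewrite (eq_bigr (fun=> 1 - p)) => [|i /andP[_ /negbTE ->] //].
rewrite prodr_const; congr (_ ^+ _).
transitivity #|~: (i0 |: S)|%SET.
  apply: eq_card => i; rewrite -[LHS]/((i != i0) && (i \notin S)).
  by rewrite !inE negb_or.
by rewrite cardsCs finset.setCK cardsU1 i0S card_ord add1n subSS.
Qed.

(** The event prescribes the remaining edges at [a] and those at [b], two disjoint families; this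
    gives the independence of the degrees. *)
Lemma cond_expect_nbrs_eq (S T : {set 'I_m.+1}) : b \notin S -> a \notin T ->
  E (fun w => ((nbrsA a b w == S) && (nbrsB a b w == T))%:R) =
  (p ^+ #|S| * (1 - p) ^+ (m - #|S|)) * (p ^+ #|T| * (1 - p) ^+ (m - #|T|)).
Proof.
move=> bS aT.
(* The constraint that the event puts on the state [c] of the edge [e]; the forced edge and the
   edges away from [a] and [b] are free. *)
pose B (e : edge) c := if (e.1 == a) && (e.2 != b) then c == (e.2 \in S)
  else if (e.1 != a) && (e.2 == b) then c == (e.1 \in T) else true.
pose h e c : R := (B e c)%:R.
transitivity (E (fun w => \prod_e h e (w e))).
  apply: eq_cond_expect => // w wab; rewrite /h prod_bool; congr (_%:R).
  congr nat_of_bool; apply/andP/forallP => [[/eqP AS /eqP BT] [x y]|H].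
    rewrite /B /= -AS -BT !inE.
    by case: (eqVneq x a) => [->|xa] /=; case: (eqVneq y b) => [->|yb] /=.
  split; apply/eqP/setP => z; rewrite inE.
    have [->|zb] := eqVneq z b; first by rewrite (negbTE bS).
    by have := H (a, z); rewrite /B /= eqxx zb /= => /eqP.
  have [->|za] := eqVneq z a; first by rewrite (negbTE aT).
  by have := H (z, b); rewrite /B /= eqxx za (negbTE za) /= => /eqP.
rewrite cond_expect_prod -(prod_neq_subset bS) -(prod_neq_subset aT).
pose v x y := if (x, y) == (a, b) then h (x, y) true
  else p * h (x, y) true + (1 - p) * h (x, y) false.
transitivity (\prod_x \prod_y v x y).
  by rewrite pair_bigA; apply: eq_bigr => -[x y].
rewrite (bigD1 a) //=; congr (_ * _).
  rewrite (bigD1 b) //= {1}/v eqxx /h /B /= !eqxx /= mul1r.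
  apply: eq_bigr => y yb; rewrite /v xpair_eqE eqxx (negbTE yb) /h /B /= eqxx yb /=.
  by case: (y \in S); rewrite /= ?mulr1 ?mulr0 ?addr0 ?add0r.
apply: eq_bigr => x xa; rewrite (bigD1 b) //= big1 ?mulr1.
  rewrite /v xpair_eqE (negbTE xa) /h /B /= eqxx (negbTE xa) /=.
  by case: (x \in T); rewrite /= ?mulr1 ?mulr0 ?addr0 ?add0r.
move=> y yb; rewrite /v xpair_eqE (negbTE xa) /h /B /= (negbTE xa) (negbTE yb) /=.
by ring.
Qed.

Definition binomial_weight (k : nat) : R := 'C(m, k)%:R * p ^+ k * (1 - p) ^+ (m - k).

Lemma cond_expect_degrees (k l : nat) :
  E (fun w => ((#|nbrsA a b w| == k) && (#|nbrsB a b w| == l))%:R) =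
  binomial_weight k * binomial_weight l.
Proof.
pose PA := [set S : {set 'I_m.+1} | (S \subset [set~ b]) && (#|S| == k)]%SET.
pose PB := [set T : {set 'I_m.+1} | (T \subset [set~ a]) && (#|T| == l)]%SET.
have subC (i : 'I_m.+1) (S : {set 'I_m.+1}) : (S \subset [set~ i]%SET) = (i \notin S).
  by rewrite finset.subsetC finset.sub1set inE.
have delta (I : finType) (P : {set I}) (X : I) : \sum_(S in P) (X == S)%:R = (X \in P)%:R :> R.
  case: (boolP (X \in P)) => XP.
    rewrite (bigD1 X) //= eqxx big1 ?addr0 // => S /andP[_ /negbTE].
    by rewrite eq_sym => ->.
  by rewrite big1 // => S SP; case: eqVneq => // XS; rewrite XS SP in XP.
transitivity (\sum_(S in PA) \sum_(T in PB)
    E (fun w => ((nbrsA a b w == S) && (nbrsB a b w == T))%:R)).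
  under eq_bigr do rewrite -cond_expect_sum.
  rewrite -cond_expect_sum; apply: eq_cond_expect => // w _.
  transitivity ((\sum_(S in PA) (nbrsA a b w == S)%:R) *
                (\sum_(T in PB) (nbrsB a b w == T)%:R) : R).
    rewrite !delta !inE !subC !inE !eqxx /= .
    by case: (_ == k) => /=; rewrite ?mul1r ?mul0r.
  rewrite mulr_suml; apply: eq_bigr => S _; rewrite mulr_sumr.
  by apply: eq_bigr => T _; rewrite -natrM mulnb.
rewrite (eq_bigr (fun=> \sum_(T in PB) (p ^+ k * (1 - p) ^+ (m - k)) *
   (p ^+ l * (1 - p) ^+ (m - l)))); last first.
  move=> S; rewrite inE subC => /andP[bS /eqP cS]; apply: eq_bigr => T.
  by rewrite inE subC => /andP[aT /eqP cT]; rewrite cond_expect_nbrs_eq // cS cT.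
rewrite !sumr_const -mulrnA.
have -> : #|PA| = 'C(m, k) by rewrite cards_draws cardsC1 card_ord.
have -> : #|PB| = 'C(m, l) by rewrite cards_draws cardsC1 card_ord.
by rewrite -mulr_natl natrM /binomial_weight; ring.
Qed.

(** The two expectations differ only if a 4-cycle passes through the edge, with error [2 * M], or if
    one of the two counts reaches [K], with error [M]. Both events are controlled by first
    moments. *)
Lemma cond_expect_kappa_binomial (f : R -> R) (M : R) (K : nat) :
  (forall x, `|f x| <= M) -> (0 < K)%N ->
  `|E (fun w => f (kappa a b w)) - \sum_(k < K) \sum_(l < K)
      binomial_weight k * binomial_weight l * f (limit_fun k l)| <=
  2 * M * ((m%:R * p) * (m%:R * p ^+ 2)) + 2 * M * (m%:R * p) / K%:R.
Proof.
move=> fM K0; have K0' : 0 < K%:R :> R by rewrite ltr0n.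
have M0 : 0 <= M by apply: le_trans (fM 0).
(* [G] is [f (limit_fun nA nB)] cut off to 0 as soon as a count reaches [K]. *)
pose G (w : config m) : R := \sum_(k < K) \sum_(l < K)
  f (limit_fun k l) * ((#|nbrsA a b w| == k) && (#|nbrsB a b w| == l))%:R.
have -> : \sum_(k < K) \sum_(l < K)
    binomial_weight k * binomial_weight l * f (limit_fun k l) = E G.
  rewrite /G cond_expect_sum; apply: eq_bigr => k _.
  rewrite cond_expect_sum; apply: eq_bigr => l _.
  by rewrite cond_expectZ cond_expect_degrees mulrC.
have GE w : G w = if (#|nbrsA a b w| < K)%N && (#|nbrsB a b w| < K)%N then
    f (limit_fun #|nbrsA a b w| #|nbrsB a b w|) else 0.
  rewrite /G; case: ltnP => /= [AK|AK]; last first.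
    rewrite big1 // => k _; rewrite big1 // => l _; rewrite gtn_eqF ?mulr0 //.
    by apply: leq_trans AK.
  case: ltnP => [BK|BK]; last first.
    rewrite big1 // => k _; rewrite big1 // => l _; rewrite andbC gtn_eqF ?mulr0 //.
    by apply: leq_trans BK.
  rewrite (bigD1 (Ordinal AK)) //= (bigD1 (Ordinal BK)) //= !eqxx mulr1.
  rewrite [X in _ + X + _]big1; last first.
    move=> l; rewrite -val_eqE /= eq_sym => /negbTE ->; by rewrite mulr0.
  rewrite [X in _ + X]big1 ?addr0 // => k; rewrite -val_eqE /= eq_sym => /negbTE ->.
  by rewrite big1 // => l _; rewrite mulr0.
pose C (w : config m) : R := \sum_(y | y != b) (w (a, y))%:R * cycles4 R a b w y.
have C0 w : 0 <= C w.
  by apply: sumr_ge0 => y _; rewrite mulr_ge0 // cycles4_ge0.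
pose H w := 2 * M * C w + M / K%:R * (#|nbrsA a b w|%:R + #|nbrsB a b w|%:R).
have key (w : config m) : w (a, b) -> `|f (kappa a b w) - G w| <= H w.
  move=> wab; have H0 : 0 <= M / K%:R * (#|nbrsA a b w|%:R + #|nbrsB a b w|%:R).
    by rewrite mulr_ge0 ?divr_ge0 ?addr_ge0.
  have GM : `|G w| <= M by rewrite GE; case: ifP => _; rewrite ?normr0.
  have [/existsP[y /existsP[x /and5P[yb xa way wxb wxy]]]|no] := boolP [exists y, exists x,
      [&& y != b, x != a, w (a, y), w (x, b) & w (x, y)]].
    have C1 : 1 <= C w.
      rewrite /C (bigD1 y) //= way mul1r -[leLHS]addr0; apply: lerD; last first.
        by apply: sumr_ge0 => z _; rewrite mulr_ge0 // cycles4_ge0.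
      rewrite /cycles4 (bigD1 x) //= wxb wxy mulr1 lerDl.
      by apply: sumr_ge0 => z _; rewrite mulr_ge0.
    apply: le_trans (ler_normB _ _) _; have := fM (kappa a b w).
    have : 2 * M * 1 <= 2 * M * C w by rewrite ler_wpM2l // mulr_ge0.
    by rewrite /H; lra.
  have -> : kappa a b w = limit_fun #|nbrsA a b w| #|nbrsB a b w| :> R.
    apply: kappa_no_cycles4 => // y yb way; rewrite /cycles4 big1 // => x xa.
    apply/eqP; rewrite -natrM mulnb pnatr_eq0 eqb0; apply/negP => /andP[wxb wxy].
    move/negP: no; apply; apply/existsP; exists y; apply/existsP; exists x.
    by rewrite yb xa way wxb wxy.
  have MC0 : 0 <= 2 * M * C w by rewrite !mulr_ge0.
  rewrite GE; case: ifP => [_|]; first by rewrite subrr normr0 addr_ge0.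
  move=> /negbT; rewrite negb_and -!leqNgt => KAB; rewrite subr0.
  apply: le_trans (fM _) _; rewrite /H -[leLHS]add0r; apply: lerD => //.
  rewrite mulrAC ler_pdivlMr // ler_wpM2l // -natrD ler_nat.
  by case/orP: KAB => h; apply: leq_trans h _; rewrite ?leq_addr ?leq_addl.
apply: (@le_trans _ _ (E H)).
  have EB : E (fun w => f (kappa a b w)) - E G = E (fun w => f (kappa a b w) - G w).
    by rewrite cond_expectD; congr (_ + _); rewrite -mulN1r -cond_expectZ;
       apply: eq_bigr => w _; rewrite mulN1r.
  rewrite EB ler_norml; apply/andP; split.
    have -> : - E H = E (fun w => -1 * H w) by rewrite cond_expectZ mulN1r.
    apply: le_cond_expect => // w /key; rewrite ler_norml mulN1r.
    by case/andP.
  by apply: le_cond_expect => // w /key; rewrite ler_norml => /andP[].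
rewrite /H cond_expectD !cond_expectZ cond_expectD cond_expect_nbrsA cond_expect_nbrsB.
rewrite /C cond_expect_count_cycles4 //.
by rewrite le_eqVlt; apply/orP; left; apply/eqP; field; rewrite gt_eqF.
Qed.

Lemma isolated_edgeE (w : config m) : isolated_edge a b w =
  [&& w (a, b), #|nbrsA a b w| == 0%N & #|nbrsB a b w| == 0%N].
Proof.
rewrite /isolated_edge !cards_eq0; congr [&& _, _ & _].
  apply/forallP/eqP => [H|/setP H y].
    by apply/setP => y; rewrite !inE; apply/negbTE; rewrite negb_and -implybE.
  by have := H y; rewrite !inE => /negbT; rewrite negb_and -implybE.
apply/forallP/eqP => [H|/setP H y].
  by apply/setP => y; rewrite !inE; apply/negbTE; rewrite negb_and -implybE.
by have := H y; rewrite !inE => /negbT; rewrite negb_and -implybE.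
Qed.

Lemma kappa_isolated (w : config m) : isolated_edge a b w -> kappa a b w = 0 :> R.
Proof.
rewrite isolated_edgeE => /and3P[wab A0 B0]; rewrite kappa_no_cycles4 //.
  rewrite (eqP A0) (eqP B0) /limit_fun addr0 invr1.
  by rewrite [Num.max _ _]max_r ?mulr0 //; lra.
move=> y yb way; move: A0; rewrite cards_eq0 => /eqP/setP/(_ y).
by rewrite !inE yb way.
Qed.

(** Union bound: the indicator of isolation is at least 1 minus the number of further edges at [a]
    or [b]. *)
Lemma cond_prob_isolated :
  1 - 2 * (m%:R * p) <= cond_prob p a b (isolated_edge a b) <= 1.
Proof.
rewrite cond_probE; apply/andP; split; last first.
  rewrite -[leRHS](cond_expect_cst p a b); apply: le_cond_expect => // w _.
  by case: isolated_edge.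
have -> : 1 - 2 * (m%:R * p) =
    E (fun w => 1 + -1 * (#|nbrsA a b w|%:R + #|nbrsB a b w|%:R)).
  rewrite cond_expectD cond_expectZ cond_expectD cond_expect_cst //.
  by rewrite cond_expect_nbrsA cond_expect_nbrsB; ring.
apply: le_cond_expect => // w wab; rewrite isolated_edgeE wab /=.
case: eqP => [->|/eqP]; last first.
  rewrite -lt0n -(ler_nat R) /=.
  have : 0 <= #|nbrsB a b w|%:R :> R by [].
  lra.
case: eqP => [->|/eqP] /=; first by lra.
rewrite -lt0n -(ler_nat R) /=; lra.
Qed.

End DegreeLaw.

(** * Limits *)

Lemma cvgyV0 (R : realType) (u : nat -> R) :
  u @ \oo --> +oo -> (fun n => (u n)^-1) @ \oo --> (0 : R).
Proof.
move=> /cvgryPge uy; apply/cvgrPdist_le => e e0.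
have := uy e^-1; apply: filterS => n un.
have u0 : 0 < u n by apply: lt_le_trans un; rewrite invr_gt0.
by rewrite sub0r normrN gtr0_norm ?invr_gt0 // invf_ple // posrE.
Qed.

Lemma cvg_near_eq (R : realType) (u v : nat -> R) (l : R) :
  u @ \oo --> l -> (\forall n \near \oo, u n = v n) -> v @ \oo --> l.
Proof.
move=> ul uv; apply: cvg_trans ul; exact: near_eq_cvg.
Qed.

Lemma cvg_sqrt0 (R : realType) (u : nat -> R) :
  u @ \oo --> (0 : R) -> (fun n => Num.sqrt (u n)) @ \oo --> (0 : R).
Proof.
move=> u0; rewrite -[X in _ --> X](@sqrtr0 R).
exact: (continuous_cvg _ (@sqrt_continuous R 0) u0).
Qed.

(* [A] is Cauchy because both [A K] and [A K'] are close to a common [E m]. *)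
Lemma cvg_approx_lim (R : realType) (E A c d : nat -> R) (S : nat -> nat -> R) :
  (forall K, S K @ \oo --> A K) ->
  (forall K m, (0 < K)%N -> `|E m - S K m| <= c m / K%:R + d m) ->
  d @ \oo --> (0 : R) -> (exists C : R, \forall m \near \oo, c m <= C) ->
  E @ \oo --> lim (A @ \oo).
Proof.
move=> SA ES d0 [C0 cC0].
have [C [C1 cC]] : exists C : R, 0 < C /\ \forall m \near \oo, c m <= C.
  exists (Num.max C0 1); split; first by rewrite lt_max ltr01 orbT.
  by apply: filterS cC0 => m h; rewrite le_max h.
(* The order of limits matters: [K] is chosen first, to make [C / K] small, and [m] is then large
   depending on [K]. *)
have H (e : R) : 0 < e -> \forall K \near \oo, \forall m \near \oo, `|E m - A K| <= e.
  move=> e0; near=> K.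
  have K0 : (0 < K)%N by near: K; exact: nbhs_infty_gt.
  have K0' : 0 < K%:R :> R by rewrite ltr0n.
  have KC : C / K%:R <= e / 3.
    rewrite ler_pdivrMr // -ler_pdivrMl ?divr_gt0 //.
    by near: K; exact: nbhs_infty_ger.
  have e3 : 0 < e / 3 by rewrite divr_gt0.
  have h1 := (iffLR (cvgrPdist_le _ _) (SA K)) _ e3.
  have h2 := (iffLR (cvgrPdist_le _ _) d0) _ e3.
  near=> m.
  have c1 : c m / K%:R <= C / K%:R.
    rewrite ler_wpM2r ?invr_ge0 ?(ltW K0') //.
    by near: m.
  have s1 : `|A K - S K m| <= e / 3 by near: m; exact: h1.
  have d1 : `|0 - d m| <= e / 3 by near: m; exact: h2.
  have := ES K m K0.
  have -> : E m - A K = (E m - S K m) - (A K - S K m) by ring.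
  have := ler_normB (E m - S K m) (A K - S K m).
  by have := ler_norm (d m); rewrite sub0r normrN in d1; lra.
have cA : cvg (A @ \oo).
  apply/cauchy_cvgP/cauchy_exP => e e0.
  have e3 : 0 < e / 3 by rewrite divr_gt0.
  have [K hK] := filter_ex (H _ e3); exists (A K).
  apply: filterS (H _ e3) => K' hK'; rewrite -ball_normE /ball_ /=.
  have [m [m1 m2]] := filter_ex (filterI hK hK').
  have -> : A K - A K' = (E m - A K') - (E m - A K) by ring.
  by have := ler_normB (E m - A K') (E m - A K); lra.
apply/cvgrPdist_le => e e0; have e3 : 0 < e / 2 by rewrite divr_gt0.
have hA : \forall K \near \oo, `|lim (A @ \oo) - A K| <= e / 2.
  exact: (iffLR (cvgrPdist_le _ _) cA).
have [K [h1 h2]] := filter_ex (filterI hA (H _ e3)).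
apply: filterS h2 => m h2.
have -> : lim (A @ \oo) - E m = (lim (A @ \oo) - A K) - (E m - A K) by ring.
by have := ler_normB (lim (A @ \oo) - A K) (E m - A K); lra.
Unshelve. all: by end_near. Qed.

(** * Poisson limit of the binomial weights *)

Section BinomialPoisson.
Variables (R : realType) (q : nat -> R) (lam : R).
Hypothesis q01 : forall m, 0 <= q m <= 1.
Hypothesis lam_gt0 : 0 < lam.
Hypothesis mq : (fun m => m%:R * q m) @ \oo --> lam.

Lemma q_cvg0 : q @ \oo --> (0 : R).
Proof.
have h := @cvgyV0 R _ (@cvgr_idn R).
have hh : (fun m => m%:R^-1 * (m%:R * q m)) @ \oo --> (0 : R).
  by rewrite -(mul0r lam); exact: cvgM h mq.
apply: (cvg_near_eq hh); near=> m => /=.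
have m0 : (0 < m)%N by near: m; exact: nbhs_infty_gt.
by rewrite mulrA mulVf ?mul1r // pnatr_eq0 -lt0n.
Unshelve. all: by end_near. Qed.

Lemma cvg_subn_q (k : nat) : (fun m => (m - k)%:R * q m) @ \oo --> lam.
Proof.
have hh : (fun m => m%:R * q m - k%:R * q m) @ \oo --> lam.
  rewrite -[X in _ --> X]subr0; apply: cvgB => //.
  rewrite -(mulr0 k%:R); apply: cvgMr; exact: q_cvg0.
apply: (cvg_near_eq hh); near=> m => /=.
have mk : (k <= m)%N by near: m; exact: nbhs_infty_ge.
by rewrite natrB // mulrBl.
Unshelve. all: by end_near. Qed.

(** The falling factorial splits into [k] factors [(m - i) * q m], each tending to [lam]. *)
Lemma cvg_ffact_q (k : nat) : (fun m => (m ^_ k)%:R * q m ^+ k) @ \oo --> lam ^+ k.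
Proof.
elim: k => [|k IH].
  rewrite expr0; under eq_fun do rewrite ffactn0 expr0 mulr1.
  exact: cvg_cst.
have hh : (fun m => (m ^_ k)%:R * q m ^+ k * ((m - k)%:R * q m)) @ \oo --> lam ^+ k.+1.
  by rewrite exprSr; exact: cvgM IH (cvg_subn_q k).
apply: (cvg_near_eq hh); apply: nearW => m /=.
by rewrite ffactnSr natrM exprSr; ring.
Qed.

(** Squeeze between [exp (- q / (1 - q)) <= 1 - q <= exp (- q)]; both sides come from
    [1 + x <= exp x], the left one at [x = q / (1 - q)]. *)
Lemma cvg_1subq_exp (k : nat) : (fun m => (1 - q m) ^+ (m - k)) @ \oo --> expR (- lam).
Proof.
have expcvg (u : nat -> R) : u @ \oo --> lam ->
    (fun m => expR (- u m)) @ \oo --> expR (- lam).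
  by move=> ul; apply: (continuous_cvg _ (@continuous_expR R (- lam))); exact: cvgN.
have up := expcvg _ (cvg_subn_q k).
have lo : (fun m => expR (- (m%:R * q m / (1 - q m)))) @ \oo --> expR (- lam).
  apply: expcvg; rewrite -[X in _ --> X]divr1 -[X in _ / X]subr0.
  apply: cvgM => //; apply: cvgV; first by rewrite subr0 oner_neq0.
  by apply: cvgB; [exact: cvg_cst|exact: q_cvg0].
apply: squeeze_cvgr lo up.
have e2 : 0 < 1 / 2 :> R by rewrite divr_gt0.
have small : \forall m \near \oo, `|0 - q m| <= 1 / 2.
  exact: (iffLR (cvgrPdist_le _ _) q_cvg0).
apply: filterS small => m.
have /andP[q0 q1] := q01 m; rewrite sub0r normrN ger0_norm // => q2.
have q3 : 0 < 1 - q m by lra.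
apply/andP; split.
  (* As [1 - q m] is at most 1, raising the exponent from [m - k] to [m] only lowers the power. *)
  apply: (@le_trans _ _ ((1 - q m) ^+ m)); last first.
    by rewrite ler_wiXn2l ?leq_subr //; lra.
  rewrite -mulrA -mulrN expRM_natl lerXn2r ?nnegrE ?expR_ge0 //; first lra.
  rewrite expRN -[leRHS]invrK lef_pV2 ?posrE ?invr_gt0 ?expR_gt0 //.
  apply: le_trans (expR_ge1Dx _); rewrite le_eqVlt; apply/orP; left; apply/eqP.
  by field; lra.
rewrite -mulrN expRM_natl lerXn2r ?nnegrE ?expR_ge0 //; first lra.
exact: expR_ge1Dx.
Qed.

Lemma cvg_binomial_weight (k : nat) :
  (fun m => binomial_weight m (q m) k) @ \oo --> poisson_pmf lam k.
Proof.
rewrite /poisson_pmf lam_gt0.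
have hh : (fun m => (m ^_ k)%:R * q m ^+ k * k`!%:R^-1 * (1 - q m) ^+ (m - k))
    @ \oo --> lam ^+ k * k`!%:R^-1 * expR (- lam).
  apply: cvgM; last exact: cvg_1subq_exp.
  by apply: cvgM; [exact: cvg_ffact_q|exact: cvg_cst].
apply: (cvg_near_eq hh); apply: nearW => m /=.
rewrite /binomial_weight -bin_ffact natrM; congr (_ * _).
by field; rewrite pnatr_eq0 -lt0n fact_gt0.
Qed.

End BinomialPoisson.

Lemma cvg_sumr (R : realType) (I : Type) (r : seq I) (u : I -> nat -> R) (l : I -> R) :
  (forall i, u i @ \oo --> l i) ->
  (fun m => \sum_(i <- r) u i m) @ \oo --> \sum_(i <- r) l i.
Proof.
move=> ul; elim: r => [|i r IH].
  by rewrite big_nil; under eq_fun do rewrite big_nil; exact: cvg_cst.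
by rewrite big_cons; under eq_fun do rewrite big_cons; exact: cvgD.
Qed.

(** * The four regimes *)

Section Regimes.
Variables (R : realType) (p : nat -> R) (a b : forall m : nat, 'I_m.+1).
Hypothesis hp : forall n, 0 <= p n <= 1.

Lemma cvg_shiftS_p (k : nat) (l : set_system R) :
  (fun n => n%:R * p n ^+ k) @ \oo --> l ->
  (fun m => m.+1%:R * p m.+1 ^+ k) @ \oo --> l.
Proof. by rewrite -(cvg_shiftS (fun n => n%:R * p n ^+ k)). Qed.

Lemma cvg_isolated : (fun n => n%:R * p n) @ \oo --> (0 : R) ->
  (fun m => cond_prob (p m.+1) (a m) (b m) (isolated_edge (a m) (b m)))
    @ \oo --> (1 : R).
Proof.
move=> np; have np' := @cvg_shiftS_p 1 _ np.
apply: (@squeeze_cvgr _ _ _ _ (fun m => 1 - 2 * (m.+1%:R * p m.+1)) (fun=> 1)).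
- apply: nearW => m; have /andP[p0 p1] := hp m.+1.
  have /andP[h1 h2] := cond_prob_isolated (a m) (b m) (hp m.+1).
  apply/andP; split => //; apply: le_trans h1.
  by rewrite lerD2l lerN2 ler_wpM2l // ler_wpM2r // ler_nat.
- rewrite -[X in _ --> X]subr0 -[X in _ - X](mulr0 2).
  by apply: cvgB; [exact: cvg_cst|apply: cvgM; [exact: cvg_cst|exact: np']].
- exact: cvg_cst.
Qed.

Lemma cvg_cond_prob0 (X : forall m, config m -> R) (B : nat -> R) (eps : R) :
  0 < eps -> (forall m w, 0 <= X m w) ->
  (\forall m \near \oo, cond_expect (p m.+1) (a m) (b m) (X m) <= B m) ->
  B @ \oo --> (0 : R) ->
  (fun m => cond_prob (p m.+1) (a m) (b m) (fun w => eps < X m w)) @ \oo --> (0 : R).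
Proof.
move=> eps0 X0 XB B0.
apply: (@squeeze_cvgr _ _ _ _ (fun=> 0) (fun m => eps^-1 * B m)).
- apply: filterS XB => m XB; apply/andP; split.
    by apply: sumr_ge0 => w _; apply: cond_weight_ge0.
  apply: le_trans (cond_prob_markov (hp m.+1) eps0 _) _ => //.
  by rewrite ler_wpM2l // invr_ge0 ltW.
- exact: cvg_cst.
- by rewrite -(mulr0 eps^-1); apply: cvgM; [exact: cvg_cst|].
Qed.

(** The moment bounds count the [m] vertices other than the fixed one, the hypotheses all [m.+1] of
    them; the factor 2 bridges the gap. *)
Lemma natSM_le_double (m : nat) (x : R) : (0 < m)%N -> 0 <= x ->
  m.+1%:R * x <= 2 * (m%:R * x).
Proof.
move=> m0 x0; rewrite mulrA ler_wpM2r // -natrM ler_nat mul2n -addnn -addn1.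
by rewrite leq_add2l.
Qed.

Lemma cvg_kappaN2 (eps : R) : (fun n => n%:R * p n) @ \oo --> +oo ->
  (fun n => n%:R * p n ^+ 2) @ \oo --> (0 : R) -> 0 < eps ->
  (fun m => cond_prob (p m.+1) (a m) (b m)
              (fun w => eps < `|kappa (a m) (b m) w - (-2)|)) @ \oo --> (0 : R).
Proof.
move=> np np2 eps0.
have npS := @cvg_shiftS_p 1 _ np; have np2S := cvg_shiftS_p np2.
pose u m := 2 / (m.+1%:R * p m.+1 ^+ 1).
have u0 : u @ \oo --> (0 : R).
  by rewrite -(mulr0 2); apply: cvgM; [exact: cvg_cst|exact: cvgyV0].
apply: (@cvg_cond_prob0 (fun m w => `|kappa (a m) (b m) w - (-2)|)
  (fun m => 8 * u m + 12 * Num.sqrt (u m) + 4 * (m.+1%:R * p m.+1 ^+ 2))) => //.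
  have big : \forall m \near \oo, 1 <= m.+1%:R * p m.+1 ^+ 1.
    exact: (iffLR (cvgryPge _) npS).
  near=> m.
  have m0 : (0 < m)%N by near: m; exact: nbhs_infty_gt.
  have T1 : 1 <= m.+1%:R * p m.+1 ^+ 1 by near: m.
  have /andP[p0 p1] := hp m.+1.
  (* Positivity of [p] holds eventually, once the mean is at least 1. *)
  have pgt0 : 0 < p m.+1.
    by rewrite lt_neqAle p0 andbT; apply: contraTneq T1 => <-; rewrite expr1 mulr0 ler10.
  apply: le_trans (cond_expect_kappaD2 _ _ (hp m.+1) pgt0 m0) _.
  have t0 : 0 < m%:R * p m.+1 by rewrite mulr_gt0 // ltr0n.
  have tu : (m%:R * p m.+1)^-1 <= u m.
    rewrite /u expr1 -[leRHS]invrK lef_pV2 ?posrE ?invr_gt0 ?divr_gt0 ?mulr_gt0 ?ltr0n //.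
    by rewrite invf_div ler_pdivrMr // [leRHS]mulrC natSM_le_double.
  have su : Num.sqrt (m%:R * p m.+1)^-1 <= Num.sqrt (u m) by rewrite ler_wsqrtr.
  have ss : m%:R * p m.+1 ^+ 2 <= m.+1%:R * p m.+1 ^+ 2.
    by rewrite ler_wpM2r ?exprn_ge0 // ler_nat.
  lra.
rewrite -[X in _ --> X](addr0 (0 : R)) -[X in _ --> X + _](addr0 (0 : R)).
rewrite -[X in _ --> X + _ + _](mulr0 8) -[X in _ --> _ + X + _](mulr0 12).
rewrite -[X in _ --> _ + X](mulr0 4).
apply: cvgD; first apply: cvgD; apply: cvgM; try exact: cvg_cst; try by [].
exact: cvg_sqrt0.
Unshelve. all: by end_near. Qed.

Lemma cvg_kappa0 (eps : R) : (fun n => n%:R * p n ^+ 2) @ \oo --> +oo -> 0 < eps ->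
  (fun m => cond_prob (p m.+1) (a m) (b m)
              (fun w => eps < `|kappa (a m) (b m) w|)) @ \oo --> (0 : R).
Proof.
move=> np2 eps0; have np2S := cvg_shiftS_p np2.
pose u m := 2 / (m.+1%:R * p m.+1 ^+ 2).
have u0 : u @ \oo --> (0 : R).
  by rewrite -(mulr0 2); apply: cvgM; [exact: cvg_cst|exact: cvgyV0].
(* As [p <= 1], the mean [m * p] dominates [m * p ^ 2], so one [u] serves for both, and 36 is 30 +
   6. *)
apply: (@cvg_cond_prob0 (fun m w => `|kappa (a m) (b m) w|)
  (fun m => 24 * u m + 36 * Num.sqrt (u m))) => //.
  have big : \forall m \near \oo, 1 <= m.+1%:R * p m.+1 ^+ 2.
    exact: (iffLR (cvgryPge _) np2S).
  near=> m.
  have m0 : (0 < m)%N by near: m; exact: nbhs_infty_gt.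
  have T1 : 1 <= m.+1%:R * p m.+1 ^+ 2 by near: m.
  have /andP[p0 p1] := hp m.+1.
  have pgt0 : 0 < p m.+1.
    rewrite lt_neqAle p0 andbT; apply: contraTneq T1 => <-.
    by rewrite expr0n mulr0 ler10.
  apply: le_trans (cond_expect_kappa _ _ (hp m.+1) pgt0 m0) _.
  have t0 : 0 < m%:R * p m.+1 by rewrite mulr_gt0 // ltr0n.
  have s0 : 0 < m%:R * p m.+1 ^+ 2 by rewrite mulr_gt0 ?exprn_gt0 // ltr0n.
  have st : (m%:R * p m.+1)^-1 <= (m%:R * p m.+1 ^+ 2)^-1.
    by rewrite lef_pV2 ?posrE // ler_wpM2l // expr2 ler_piMr.
  have tu : (m%:R * p m.+1 ^+ 2)^-1 <= u m.
    rewrite /u -[leRHS]invrK lef_pV2 ?posrE ?invr_gt0 ?divr_gt0 ?mulr_gt0 ?exprn_gt0 ?ltr0n //.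
    by rewrite invf_div ler_pdivrMr // [leRHS]mulrC natSM_le_double // exprn_ge0.
  have su : Num.sqrt (m%:R * p m.+1 ^+ 2)^-1 <= Num.sqrt (u m) by rewrite ler_wsqrtr.
  have sut : Num.sqrt (m%:R * p m.+1)^-1 <= Num.sqrt (u m).
    by rewrite ler_wsqrtr //; apply: le_trans st tu.
  lra.
rewrite -[X in _ --> X](addr0 (0 : R)) -[X in _ --> X + _](mulr0 24).
rewrite -[X in _ --> _ + X](mulr0 36).
by apply: cvgD; apply: cvgM; try exact: cvg_cst; [exact: u0 | exact: cvg_sqrt0].
Unshelve. all: by end_near. Qed.

(** For fixed [K] the truncated binomial sums tend to Poisson sums. The truncation error [c m / K]
    is small uniformly in large [m], and the 4-cycle error [d m] tends to 0. *)
Lemma cvg_kappa_poisson (lam : R) (f : R -> R) : 0 < lam ->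
  (fun n => n%:R * p n) @ \oo --> lam -> (exists M : R, forall x, `|f x| <= M) ->
  (fun m => cond_expect (p m.+1) (a m) (b m) (fun w => f (kappa (a m) (b m) w)))
    @ \oo --> limit_expect lam f.
Proof.
move=> lam0 np [M fM]; have npS := @cvg_shiftS_p 1 _ np.
pose q m := p m.+1.
have q01 m : 0 <= q m <= 1 := hp m.+1.
have q0 : q @ \oo --> (0 : R).
  have hh : (fun m => m.+1%:R^-1 * (m.+1%:R * p m.+1 ^+ 1)) @ \oo --> (0 : R).
    by rewrite -(mul0r lam); apply: cvgM npS; exact: cvg_harmonic.
  apply: (cvg_near_eq hh); apply: nearW => m.
  by rewrite mulrA mulVf ?mul1r ?expr1.
have mq : (fun m => m%:R * q m) @ \oo --> lam.
  have hh : (fun m => m.+1%:R * p m.+1 ^+ 1 - q m) @ \oo --> lam.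
    by rewrite -(subr0 lam); exact: cvgB.
  apply: (cvg_near_eq hh); apply: nearW => m.
  by rewrite -natr1 expr1 /q; ring.
pose d m := 2 * M * ((m%:R * q m) * (m%:R * q m ^+ 2)).
pose c m := 2 * M * (m%:R * q m).
pose S K m := \sum_(k < K) \sum_(l < K)
  binomial_weight m (q m) k * binomial_weight m (q m) l * f (limit_fun k l).
apply: (@cvg_approx_lim _ _ _ c d S).
- move=> K; apply: cvg_sumr => k; apply: cvg_sumr => l.
  apply: cvgM; last exact: cvg_cst.
  by apply: cvgM; exact: cvg_binomial_weight.
- move=> K m K0; rewrite [leRHS]addrC.
  exact: (cond_expect_kappa_binomial (a m) (b m) (q01 m) fM K0).
- have hh : (fun m => 2 * M * ((m%:R * q m) * (m%:R * q m * q m))) @ \oo --> (0 : R).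
    have -> : 0 = 2 * M * (lam * (lam * 0)) by rewrite !mulr0.
    apply: cvgM; first exact: cvg_cst.
    by apply: cvgM => //; apply: cvgM.
  by apply: (cvg_near_eq hh); apply: nearW => m; rewrite /d; ring.
- have M0 : 0 <= M by apply: le_trans (fM 0).
  exists (2 * M * (lam + 1)).
  have near1 : \forall m \near \oo, `|lam - m%:R * q m| <= 1.
    exact: (iffLR (cvgrPdist_le _ _) mq).
  apply: filterS near1 => m; rewrite ler_norml => /andP[h _].
  by rewrite ler_wpM2l ?mulr_ge0 //; lra.
Qed.

End Regimes.

(** Convergence in distribution in (b) is expressed by expectations of bounded continuous test
    functions. *)
Theorem theorem5p5 (R : realType) (p : nat -> R)
    (a b : forall m : nat, 'I_m.+1)
    (hp : forall n, 0 <= p n <= 1) :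
  (* (a) *)
  ( (fun n => n%:R * p n) @ \oo --> (0 : R) ->
      (fun m => cond_prob (p m.+1) (a m) (b m) (isolated_edge (a m) (b m)))
        @ \oo --> (1 : R)
      /\ (forall m (w : config m), isolated_edge (a m) (b m) w ->
            kappa (a m) (b m) w = (0 : R)) )
  /\
  (* (b) *)
  ( forall lam : R, 0 < lam ->
      (fun n => n%:R * p n) @ \oo --> lam ->
      forall f : R -> R, continuous f -> (exists M : R, forall x, `|f x| <= M) ->
        (fun m => cond_expect (p m.+1) (a m) (b m)
                    (fun w => f (kappa (a m) (b m) w)))
          @ \oo --> limit_expect lam f )
  /\
  (* (c) *)
  ( (fun n => n%:R * p n) @ \oo --> +oo ->
      (fun n => n%:R * p n ^+ 2) @ \oo --> (0 : R) ->
      forall eps : R, 0 < eps ->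
        (fun m => cond_prob (p m.+1) (a m) (b m)
                    (fun w => eps < `|kappa (a m) (b m) w - (-2)|))
          @ \oo --> (0 : R) )
  /\
  (* (d) *)
  ( (fun n => n%:R * p n ^+ 2) @ \oo --> +oo ->
      forall eps : R, 0 < eps ->
        (fun m => cond_prob (p m.+1) (a m) (b m)
                    (fun w => eps < `|kappa (a m) (b m) w|))
          @ \oo --> (0 : R) ).
Proof.
split; first by move=> np; split; [exact: cvg_isolated | move=> m w; exact: kappa_isolated].
split; first by move=> lam lam0 np f _ fM; exact: cvg_kappa_poisson.
split; first by move=> np np2 eps eps0; exact: cvg_kappaN2.
by move=> np2 eps eps0; exact: cvg_kappa0.
Qed.
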